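(* Consider the periodic initial boundary value problem $$u_{xt}+uu_{xx}-\lambda u_x^2=I(t),\quad u(x,0)=u_0(x),\quad I(t)=-(\lambda+1)\int_0^1u_x^2\,dx,\quad u(0,t)=u(1,t),\ u_x(0,t)=u_x(1,t),$$ for $x\in[0,1]$, $t>0$, with $\lambda<0$, where, for some $q>0$ and $C_2>0$, $u_0'(\alpha)\sim m_0+C_2|\alpha-\underline\alpha_j|^q$ near every $\underline\alpha_j$. Let $t_*>0$ denote the finite $L^\infty$ blow-up time for $u_x$. Then: 1. Let $q\in(0,1/2)$. Then $\lim_{t\uparrow t_*}\|u_x\|_p<+\infty$ for either $\lambda<0$ and $p\in[1,2]$, or $\frac{1}{2-p}<\lambda<0$ and $p>2$. 2. Let $q\in(1/2,1)$. Then $\lim_{t\uparrow t_*}\|u_x\|_p<+\infty$ for either $\lambda<0$ and $p\in[1,1/q]$, or $\frac{q}{1-pq}<\lambda<0$ and $p>1/q$. 3. Let $q>1$. Then $\lim_{t\uparrow t_*}\|u_x\|_p<+\infty$ for $\frac{q}{1-pq}<\lambda<0$ and $p\ge1$, whereas $\lim_{t\uparrow t_*}\|u_x\|_p=+\infty$ for $\lambda<\frac{q}{p(1-q)}$ and $p>1$. In parts 1 and 2 the following exclusions are assumed when applicable: if $\lambda<-1$, then $\lambda\neq\frac{q}{1-nq}$ and $q\ne\frac1n$ for all $n\in\mathbb{N}$; and if $\lambda<-\frac1p$, then $\lambda\notin\left\{\frac{q}{1-q(p+n)},\frac{1}{1-p}\right\}$ and $q\ne\frac1n$ for all $n\in\mathbb{N}$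 (any condition involving a zero denominator is void).
   Context: $\mathbb{N}=\{1,2,\dots\}$. Standing assumptions on the data: $u_0$ is periodic, $u_0'$ is bounded and at least continuous a.e. on $(0,1)$ (so $\int_0^1u_0'=0$); $m_0<0$ is the least value of $u_0'$, attained at finitely many points $\underline\alpha_j\in[0,1]$ (and $u_0'$ is bounded away from $m_0$ off any neighbourhood of these points). Neighbourhoods are periodic. $u_0'(\alpha)\sim m_0+C_2|\alpha-\underline\alpha_j|^q$ near $\underline\alpha_j$ means $u_0'(\alpha)-m_0$ is asymptotically equivalent (ratio $\to1$) to $C_2|\alpha-\underline\alpha_j|^q$ as $\alpha\to\underline\alpha_j$. Solutions are understood along characteristics $\gamma$, $\dot\gamma(\alpha,t)=u(\gamma(\alpha,t),t)$, $\gamma(\alpha,0)=\alpha$. For $\lambda<0$ put $\mathcal{J}(\alpha,t)=1-\lambda\eta(t)u_0'(\alpha)$, $\bar{\mathcal{K}}_i(t)=\int_0^1\mathcal{J}(\alpha,t)^{-i-1/\lambda}d\alpha$, where $\dot\eta=\bar{\mathcal{K}}_0^{-2\lambda}$, $\eta(0)=0$. The solution is given by $$\gamma_\alpha=\frac{\mathcal{J}(\alpha,t)^{-1/\lambda}}{\bar{\mathcal{K}}_0(t)},\qquad u_x(\gamma(\alpha,t),t)=\frac{1}{\lambda\eta(t)\bar{\mathcal{K}}_0(t)^{2\lambda}}\left(\frac{1}{\mathcal{J}(\alpha,t)}-\frac{\bar{\mathcal{K}}_1(t)}{\bar{\mathcal{K}}_0(t)}\right)$$ (with value $u_0'(\alpha)$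 at $t=0$) as long as $\eta(t)<\eta_*=\frac1{\lambda m_0}$, and is defined for $t\in[0,t_* )$ with $$t_*=\lim_{\eta\uparrow\eta_*}\int_0^\eta\left(\int_0^1(1-\lambda\mu u_0'(\alpha))^{-1/\lambda}d\alpha\right)^{2\lambda}d\mu,$$ which is finite and is the $L^\infty$ blow-up time of $u_x$. $\|\cdot\|_p$ is the norm of $L^p(0,1)$ in $x$, so $\|u_x(\cdot,t)\|_p^p=\int_0^1|u_x(\gamma(\alpha,t),t)|^p\gamma_\alpha(\alpha,t)\,d\alpha$. *)

(* Defs.v *)
From HB Require Import structures.
From mathcomp Require Import all_boot all_order all_algebra.
From mathcomp Require Import all_classical all_reals all_analysis.

Set Implicit Arguments.
Unset Strict Implicit.
Unset Printing Implicit Defensive.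

Import Order.TTheory GRing.Theory Num.Theory.
Import numFieldNormedType.Exports.

Local Open Scope classical_set_scope.
Local Open Scope ring_scope.

(** Functions on the circle are 1-periodic functions on [R], so that ordinary
    neighbourhoods in [R] are the periodic neighbourhoods of [0, 1].

    An a.e. continuous function need not be Borel, but it is a.e. equal to a
    Borel function; as the library integral is a lower integral (a supremum over
    simple functions), it agrees with the usual integral on such functions. *)

Definition periodic1 (R : realType) (f : R -> R) : Prop :=
  forall x, f (x + 1) = f x.

(** [du0] plays the role of u_0': since u_0' is only required to be continuous
    a.e., it enters as a function whose integral is [u0]. By [data_cont], [du0]
    is the classical derivative of [u0] at almost every point. *)
Record initial_data (R : realType) (u0 du0 : R -> R) : Prop := InitialData {
  data_per : periodic1 u0;
  data_dper : periodic1 du0;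
  data_bounded : exists M : R, forall x, `|du0 x| <= M;
  data_cont : {ae @lebesgue_measure R, forall x, x \in `]0, 1[ ->
                 {for x, continuous du0}};
  data_int : forall a b : R, a <= b ->
    u0 b - u0 a = \int[@lebesgue_measure R]_(x in `[a, b]) du0 x
}.

Record negative_minimum (R : realType) (du0 : R -> R) (m0 : R) : Prop :=
  NegativeMinimum {
  min_lt0 : m0 < 0;
  min_le : forall x, m0 <= du0 x;
  min_attained : exists x, du0 x = m0;
  min_finite : finite_set [set x : R | 0 <= x <= 1 /\ du0 x = m0];
  min_away : forall e : R, 0 < e -> exists2 d : R, 0 < d &
    forall x, (forall a, du0 a = m0 -> e <= `|x - a|) -> m0 + d <= du0 x
}.

(** u_0'(x) ~ m0 + C2 |x - a|^q as x -> a *)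
Definition min_order (R : realType) (du0 : R -> R) (m0 C2 q a : R) : Prop :=
  (du0 x - m0) / (C2 * `|x - a| `^ q) @[x --> a^'] --> (1 : R).

(** J and the integrals K_i as functions of the value [h] of eta, rather than
    of the time. *)
Definition Jfac (R : realType) (lam : R) (du0 : R -> R) (h x : R) : R :=
  1 - lam * h * du0 x.

Definition Kint (R : realType) (lam : R) (du0 : R -> R) (i : nat) (h : R) : R :=
  \int[@lebesgue_measure R]_(x in `[0, 1])
    (Jfac lam du0 h x `^ (- i%:R - lam^-1)).

Definition eta_star (R : realType) (lam m0 : R) : R := (lam * m0)^-1.

Definition t_star (R : realType) (lam : R) (du0 : R -> R) (m0 : R) : R :=
  lim ((\int[@lebesgue_measure R]_(s in `[0, h]) (Kint lam du0 0 s `^ (2 * lam)))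
         @[h --> (eta_star lam m0)^'-]).

Record eta_solution (R : realType) (lam : R) (du0 : R -> R) (m0 : R)
    (eta : R -> R) : Prop := EtaSolution {
  eta_init : eta 0 = 0;
  eta_cont : {within `[0, t_star lam du0 m0[, continuous eta};
  eta_ode : forall t, 0 < t < t_star lam du0 m0 ->
    is_derive t (1 : R) eta (Kint lam du0 0 (eta t) `^ (- (2 * lam)));
  eta_lt : forall t, 0 <= t < t_star lam du0 m0 -> eta t < eta_star lam m0
}.

(** The initial boundary value problem along characteristics: the left-hand side
    u_xt + u u_xx is the time derivative of u_x along the flow [gam] of [u]. No
    second derivative u_xx is required, as u_0' may be discontinuous; for the
    same reason [ux] is tied to [u] by integration. *)
Definition nonlocal (R : realType) (lam : R) (v : R -> R) : R :=
  - (lam + 1) * \int[@lebesgue_measure R]_(x in `[0, 1]) (v x ^+ 2).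

Record ibvp_solution (R : realType) (lam : R) (u0 du0 : R -> R) (T : R)
    (u ux gam : R -> R -> R) : Prop := IbvpSolution {
  sol_u0 : forall x, u x 0 = u0 x;
  sol_ux0 : forall x, ux x 0 = du0 x;
  sol_per : forall t, 0 <= t < T -> periodic1 (u^~ t);
  sol_dper : forall t, 0 <= t < T -> periodic1 (ux^~ t);
  sol_int : forall t, 0 <= t < T -> forall a b : R, a <= b ->
    u b t - u a t = \int[@lebesgue_measure R]_(x in `[a, b]) ux x t;
  sol_gam0 : forall x, gam x 0 = x;
  sol_cont : forall x, [/\ {within `[0, T[, continuous (gam x)},
    {within `[0, T[, continuous (fun t => u (gam x t) t)} &
    {within `[0, T[, continuous (fun t => ux (gam x t) t)}];
  sol_flow : forall x t, 0 < t < T ->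
    is_derive t (1 : R) (gam x) (u (gam x t) t);
  sol_pde : forall x t, 0 < t < T ->
    is_derive t (1 : R) (fun s => ux (gam x s) s)
      (lam * ux (gam x t) t ^+ 2 + nonlocal lam (ux^~ t))
}.

(** The formulas for gamma_alpha (in integrated form, as it exists classically
    only a.e.) and for u_x along characteristics. *)
Record representation (R : realType) (lam : R) (du0 : R -> R) (T : R)
    (eta : R -> R) (ux gam : R -> R -> R) : Prop := Representation {
  rep_gam : forall t, 0 <= t < T -> forall a b : R, a <= b ->
    gam b t - gam a t =
      \int[@lebesgue_measure R]_(x in `[a, b])
        (Jfac lam du0 (eta t) x `^ (- lam^-1) / Kint lam du0 0 (eta t));
  rep_ux : forall x t, 0 < t < T ->
    ux (gam x t) t =
      (lam * eta t * Kint lam du0 0 (eta t) `^ (2 * lam))^-1 *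
      ((Jfac lam du0 (eta t) x)^-1
         - Kint lam du0 1 (eta t) / Kint lam du0 0 (eta t))
}.

Definition Lp_norm01 (R : realType) (p : R) (f : R -> R) : \bar R :=
  ('N[@lebesgue_measure R]_(p%:E)[(EFin \o f) \_ `]0%R, 1%R[])%E.

(** The guards void the conditions with a zero denominator. *)
Definition not_exceptional (R : realType) (lam q p : R) : Prop :=
  (lam < - 1 -> forall n : nat, (0 < n)%N ->
     (1 - n%:R * q != 0 -> lam != q / (1 - n%:R * q)) /\ q != n%:R^-1) /\
  (lam < - p^-1 ->
     (forall n : nat, (0 < n)%N ->
        (1 - q * (p + n%:R) != 0 -> lam != q / (1 - q * (p + n%:R))) /\
        q != n%:R^-1) /\
     (1 - p != 0 -> lam != (1 - p)^-1)).

(* Main.v *)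
Require Import Defs.
From HB Require Import structures.
From mathcomp Require Import all_boot all_order all_algebra.
From mathcomp Require Import all_classical all_reals all_analysis.
From mathcomp Require Import measurable_realfun.
From mathcomp Require Import ring lra.

Set Implicit Arguments.
Unset Strict Implicit.
Unset Printing Implicit Defensive.

Import Order.TTheory GRing.Theory Num.Theory.
Import numFieldNormedType.Exports.

Local Open Scope classical_set_scope.
Local Open Scope ring_scope.

(** Along characteristics everything depends on the initial slope and on the
    value h of eta only. Put e = h / eta_star and
    w = J(., eta_star) = (u_0' - m_0) / |m_0|, so that J(., h) = (1 - e) + e w,
    and write b = - 1 / lam > 0; then K_i is the integral of J^(b - i) over a
    period. Since eta' = K_0(eta)^(- 2 lam), time is recovered as the integral of
    K_0^(2 lam) from 0 to eta(t), and [t_star] is that integral up to eta_star: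
    hence t -> t_* is the same as e -> 1 ([eta_cvg]).

    The minimum of u_0' is attained at finitely many points with order q, so the
    set where w < d has measure comparable with d^(1/q) for small d
    ([sublevel_measure] and [profile_exists]). Summing over dyadic levels, w^r is
    integrable on a period as soon as r > - 1/q ([integral_sublevel_power]).

    The change of variables y = gam(x, t) turns the p-th power of the norm into
    an amplitude, which tends to a positive limit, times the integral of
    |1/J - K_1/K_0|^p J^b over a period ([norm_along_flow]).

    Convergence. As J lies between min(1, w) and a constant, J^r is bounded by a
    constant plus w^r uniformly in e. If K_1 is bounded, the integrand above is at
    most a constant times J^(b - p), and dominated convergence gives a finite limit
    when p - b < 1/q ([dev_cvg]); as p >= 1, the same inequality controls K_1. All
    the ranges in which a finite limit is claimed satisfy p - b < 1/q.

    Divergence. Since (1 - e) J^(b - 1) <= J^b and (1 - e) / J -> 0 almost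
    everywhere, (1 - e) K_1/K_0 tends to 0 whether or not K_1 is bounded
    ([eps_ratio_cvg]). On the set w <= 1 - e one has J <= 2 (1 - e), so there 1/J
    is eventually at least twice K_1/K_0 and the integrand is at least of order
    (1 - e)^(b - p). That set has measure at least of order (1 - e)^(1/q), so the
    integral is at least of order (1 - e)^(b - p + 1/q), which is unbounded when
    b < p - 1/q ([dev_lower]). The condition lam < q / (p (1 - q)) reads
    b < p - p/q, which is stronger.

    The slope u_0' is only almost everywhere continuous. It is replaced by a Borel
    function that agrees with it off a periodic null set ([borel_version]); the
    integral, a supremum over simple functions, ignores null sets even for
    functions that are not measurable ([eq_integral_off_null]). *)

(** * Integrals and null sets *)

Section lower_integral.
Context d (T : measurableType d) (R : realType).
Variables (mu : {measure set T -> \bar R}) (N : set T).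
Hypotheses (mN : measurable N) (N0 : mu N = 0%E).
Local Open Scope ereal_scope.
Import HBNNSimple.

Let sintegral_off_null (h : {nnsfun T >-> R}) :
  sintegral mu (proj_nnsfun h (measurableC mN)) = sintegral mu h.
Proof.
rewrite -!integralT_nnsfun; apply: ae_eq_integral => //.
- by apply/measurable_EFinP; exact: measurable_funP.
- by apply/measurable_EFinP; exact: measurable_funP.
exists N; split => // x /= hx; apply: contrapT => Nx; apply: hx => _.
by rewrite mindicE mem_set//= mulr1.
Qed.

Let ge0_le_integral_off_null (f g : T -> \bar R) :
  (forall x, 0 <= f x) -> (forall x, 0 <= g x) ->
  (forall x, ~ N x -> f x = g x) ->
  \int[mu]_x f x <= \int[mu]_x g x.
Proof.
move=> f0 g0 fg; rewrite !ge0_integralTE//.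
apply: ge_ereal_sup => _ /= [h hf <-].
apply: ereal_sup_ubound; exists (proj_nnsfun h (measurableC mN)); last first.
  exact: sintegral_off_null.
move=> x /=; rewrite mindicE; case: (boolP (x \in ~` N)) => /=.
  by rewrite inE mulr1 /= => Nx; rewrite -fg.
by rewrite mulr0.
Qed.

(** Multiplying a simple function below f by the indicator of the complement of
    N changes neither its integral nor, when f = g off N, the fact that it lies
    below g. The integral of an arbitrary function is the supremum of the integrals
    of the simple functions below it. *)
Lemma eq_integral_off_null (D : set T) (f g : T -> \bar R) :
  (forall x, D x -> ~ N x -> f x = g x) ->
  \int[mu]_(x in D) f x = \int[mu]_(x in D) g x.
Proof.
move=> fg; rewrite integral_mkcond [RHS]integral_mkcond.
have {}fg x : ~ N x -> (f \_ D) x = (g \_ D) x.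
  by move=> Nx; rewrite !patchE; case: ifPn => // /set_mem Dx; exact: fg.
rewrite integralE [RHS]integralE; congr (_ - _); apply/eqP; rewrite eq_le;
  apply/andP; split; apply: ge0_le_integral_off_null => //= x Nx;
  by rewrite ?funeposE ?funenegE fg.
Qed.

End lower_integral.

Lemma eq_Rintegral_off_null d (T : measurableType d) (R : realType)
    (mu : {measure set T -> \bar R}) (N D : set T) (f g : T -> R) :
  measurable N -> mu N = 0%E -> (forall x, D x -> ~ N x -> f x = g x) ->
  \int[mu]_(x in D) f x = \int[mu]_(x in D) g x.
Proof.
move=> mN N0 fg; congr fine; apply: (eq_integral_off_null mN N0) => x Dx Nx.
by rewrite fg.
Qed.

(** * Change of variables and periodic integrands *)

Section density_measure.
Context d (T : measurableType d) (R : realType).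
Variables (mu : {measure set T -> \bar R}) (phi : T -> R).
Hypotheses (mphi : measurable_fun setT phi) (phi0 : forall x, 0 <= phi x).
Local Open Scope ereal_scope.

Definition density_measure (A : set T) : \bar R := \int[mu]_(x in A) (phi x)%:E.

Let density0 : density_measure set0 = 0.
Proof. exact: integral_set0. Qed.

Let density_ge0 A : 0 <= density_measure A.
Proof. by apply: integral_ge0 => x _; rewrite lee_fin. Qed.

Let density_sigma_additive : semi_sigma_additive density_measure.
Proof.
move=> /= A mA tA mUA.
rewrite /density_measure ge0_integral_bigcup//=; last 2 first.
- by apply/measurable_EFinP; exact: measurable_funTS.
- by move=> x _; rewrite lee_fin.
by apply: is_cvg_ereal_nneg_natsum_cond => n _ _; exact: density_ge0.
Qed.

HB.instance Definition _ := isMeasure.Build _ _ _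
  density_measure density0 density_ge0 density_sigma_additive.

Definition density : {measure set T -> \bar R} := density_measure.

Import HBNNSimple.

Let integral_density_nnsfun (D : set T) (h : {nnsfun T >-> R}) : measurable D ->
  \int[density]_(x in D) (h x)%:E =
  \int[mu]_(x in D) ((h x)%:E * (phi x)%:E).
Proof.
move=> mD.
have mind r : measurable (h @^-1` [set r]) by [].
under [LHS]eq_integral do rewrite fimfunE -fsumEFin//.
rewrite ge0_integral_fsum//; last 2 first.
- by move=> y; exact/measurable_EFinP/measurable_funM.
- by move=> y x _; rewrite nnfun_muleindic_ge0.
under [RHS]eq_integral.
  move=> x _; rewrite fimfunE -fsumEFin// muleC ge0_mule_fsumr; last first.
    by move=> y; rewrite nnfun_muleindic_ge0.
  over.
rewrite [RHS]ge0_integral_fsum//; last 2 first.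
- move=> y; apply/measurable_EFinP/measurable_funM; first exact: measurable_funTS.
  exact: measurable_funM.
- by move=> y x _; apply: mule_ge0; [rewrite lee_fin|exact: nnfun_muleindic_ge0].
apply: eq_fsbigr => r; rewrite inE => -[t _ htr].
have r0 : (0 <= r)%R by rewrite -htr fun_ge0.
rewrite integralZl_indic_nnsfun// integral_indic//=.
transitivity (\int[mu]_(x in D) (r%:E * ((phi x)%:E * (\1_(h @^-1` [set r]) x)%:E))).
  rewrite ge0_integralZl//; last 2 first.
  - by apply/measurable_EFinP/measurable_funM => //; exact: measurable_funTS.
  - by move=> x _; rewrite mule_ge0 ?lee_fin// indicE.
  congr (_ * _); rewrite /density_measure setIC integral_mkcondr.
  apply: eq_integral => x _; rewrite patchE indicE.
  by case: ifPn => _; rewrite ?mule1 ?mule0.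
by apply: eq_integral => x _; rewrite EFinM muleCA.
Qed.

(** Both sides agree on simple functions; the general case follows by
    monotone approximation. *)
Lemma ge0_integral_density (D : set T) (f : T -> \bar R) : measurable D ->
  measurable_fun D f -> (forall x, D x -> 0 <= f x) ->
  \int[density]_(x in D) f x = \int[mu]_(x in D) (f x * (phi x)%:E).
Proof.
move=> mD mf f0.
pose f_ := nnsfun_approx mD mf.
transitivity (limn (fun n => \int[density]_(x in D) (f_ n x)%:E)).
  rewrite -monotone_convergence//.
  - apply: eq_integral => y /[!inE] yD; apply/esym/cvg_lim => //.
    exact: cvg_nnsfun_approx.
  - by move=> n; exact/measurable_EFinP/measurable_funTS.
  - by move=> n y _; rewrite lee_fin.
  - by move=> y _ m n mn; rewrite lee_fin; exact/lefP/nd_nnsfun_approx.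
under eq_fun do rewrite integral_density_nnsfun//.
rewrite -monotone_convergence//; last 3 first.
- move=> n; apply/measurable_EFinP/measurable_funM; last exact: measurable_funTS.
  exact: measurable_funTS.
- by move=> n y _; rewrite mule_ge0 ?lee_fin.
- move=> y _ m n mn; apply: lee_wpmul2r; rewrite lee_fin//.
  exact/lefP/nd_nnsfun_approx.
apply: eq_integral => y /[!inE] yD; apply/cvg_lim => //.
apply: cvgeZr => //.
exact: cvg_nnsfun_approx.
Qed.

End density_measure.

Section change_of_variables.
Context (R : realType).
Notation mu := (@lebesgue_measure R).
Variables (gam gamV phi : R -> R).
Hypotheses (mphi : measurable_fun setT phi) (phi0 : forall x, 0 <= phi x).
Hypothesis gam_le : forall x y, (gam x <= gam y) = (x <= y).
Hypothesis gamVK : cancel gamV gam.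
Hypothesis gam_int : forall a b, a <= b ->
  (\int[mu]_(x in `[a, b]) (phi x)%:E = (gam b - gam a)%:E)%E.

Let gam_lt x y : (gam x < gam y) = (x < y).
Proof. by rewrite !ltNge gam_le. Qed.

Let mgam : measurable_fun [set: measurableTypeR R] (gam : _ -> measurableTypeR R).
Proof.
have : nondecreasing_fun gam by move=> x y xy; rewrite gam_le.
by move=> ?; apply: nondecreasing_measurable.
Qed.



Let nu : {measure set (measurableTypeR R) -> \bar R}.
Proof.
refine (pushforward (@density _ (measurableTypeR R) R mu phi mphi phi0)
  (gam : _ -> measurableTypeR R)).
exact: mgam.
Defined.

Let lebesgueE A : measurable A -> mu A = nu A.
Proof.
apply: lebesgue_measure_unique => _ [[x y] _ <-] /=.
set a := gamV x; set b := gamV y.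
rewrite /= lebesgue_measure_itv/= lte_fin -(gamVK x) -(gamVK y) -/a -/b gam_lt.
have -> : nu `]gam a, gam b]%classic = (\int[mu]_(x in `]a, b]) (phi x)%:E)%E.
  rewrite /nu /= /pushforward /density_measure; congr integral.
  by apply/seteqP; split => z /=; rewrite !in_itv/= gam_lt gam_le.
rewrite integral_itv_obnd_cbnd; last first.
  by apply/measurable_EFinP; exact: measurable_funTS.
case: ltP => [ab|ba]; first by rewrite gam_int ?ltW.
have [->|ab] := eqVneq a b; first by rewrite gam_int// subrr.
rewrite set_itv_ge ?integral_set0// -leNgt.
by rewrite bnd_simp lt_neqAle eq_sym ab.
Qed.

(** The image under gam of the measure with density phi agrees with the Lebesgue
    measure on intervals, hence on Borel sets. Here gam is an increasing bijection
    that is the integral of phi, which may be discontinuous. *)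
Lemma ge0_change_of_variables (D : set R) (f : R -> \bar R) : measurable D ->
  measurable_fun D f -> (forall x, D x -> (0 <= f x)%E) ->
  (\int[mu]_(y in D) f y = \int[mu]_(x in gam @^-1` D) (f (gam x) * (phi x)%:E))%E.
Proof.
move=> mD mf f0.
rewrite (@eq_measure_integral _ _ _ _ nu); last by move=> A mA _; exact: lebesgueE.
rewrite /nu ge0_integral_pushforward//; last first.
  by move=> x; rewrite inE; exact: f0.
rewrite ge0_integral_density//.
- by rewrite -[X in measurable X]setTI; exact: mgam.
- apply: (measurable_comp mD) => //; first by move=> _ [x Dx <-].
  exact: measurable_funTS mgam.
- by move=> x; exact: f0.
Qed.

(** The preimage under gamV is the image under gam: its measure is the integral
    of phi over N. *)
Lemma measure_image_null (N : set R) : measurable N -> mu N = 0%E ->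
  measurable (gamV @^-1` N) /\ mu (gamV @^-1` N) = 0%E.
Proof.
move=> mN N0.
have gamVle x y : (gamV x <= gamV y) = (x <= y) by rewrite -gam_le !gamVK.
have gamK : cancel gam gamV.
  by move=> x; apply/eqP; rewrite eq_le -[X in X && _]gam_le -[X in _ && X]gam_le gamVK lexx.
have mV : measurable (gamV @^-1` N).
  rewrite -[X in measurable X]setTI; apply: nondecreasing_measurable => // x y xy.
  by rewrite gamVle.
split => //; rewrite lebesgueE// /nu/= /pushforward /density_measure.
have -> : gam @^-1` (gamV @^-1` N) = N.
  by apply/seteqP; split => x /=; rewrite gamK.
apply: null_set_integral => //.
by apply/measurable_EFinP; exact: measurable_funTS.
Qed.

End change_of_variables.

Section periodic_integral.
Context (R : realType).
Notation mu := (@lebesgue_measure R).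

Let shift_le (k x y : R) : (x + k <= y + k) = (x <= y).
Proof. by rewrite lerD2r. Qed.

Let shift_int (k a b : R) : a <= b ->
  (\int[mu]_(x in `[a, b]) 1%:E = ((b + k) - (a + k))%:E)%E.
Proof.
move=> ab; rewrite integral_cst// mul1e /= lebesgue_measure_itv/= lte_fin.
have -> : b + k - (a + k) = b - a by ring.
case: (ltP a b) => // ba; have -> : a = b by apply/eqP; rewrite eq_le ab ba.
by rewrite subrr.
Qed.

(** A translation is the case phi = 1 of the change of variables. *)
Lemma ge0_integral_shift (k : R) (D : set R) (f : R -> \bar R) : measurable D ->
  measurable_fun D f -> (forall x, D x -> (0 <= f x)%E) ->
  (\int[mu]_(y in D) f y = \int[mu]_(x in (+%R^~ k) @^-1` D) f (x + k)%R)%E.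
Proof.
move=> mD mf f0.
rewrite (@ge0_change_of_variables R (+%R^~ k) (+%R^~ (- k)) (cst 1)) //.
- by apply: eq_integral => x _; rewrite mule1.
- by move=> x /=; rewrite subrK.
- exact: shift_int.
Qed.

Lemma measure_shift_null (k : R) (N : set R) : measurable N -> mu N = 0%E ->
  measurable ((+%R^~ k) @^-1` N) /\ mu ((+%R^~ k) @^-1` N) = 0%E.
Proof.
apply: (@measure_image_null R (+%R^~ (- k)) (+%R^~ k) (cst 1)) => //.
- by move=> x /=; rewrite addrK.
- exact: shift_int.
Qed.

Lemma periodic1_nat (f : R -> R) (n : nat) x : periodic1 f -> f (x + n%:R) = f x.
Proof.
move=> fp; elim: n x => [|n IH] x; first by rewrite addr0.
by rewrite -addn1 natrD addrA fp IH.
Qed.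

Lemma periodic1_int (f : R -> R) (n : int) x : periodic1 f -> f (x + n%:~R) = f x.
Proof.
move=> fp; case: n => n; first exact: periodic1_nat.
by rewrite NegzE mulrNz -[in RHS](subrK n.+1%:R x) periodic1_nat.
Qed.

(** After an integer translation c lies in [0, 1[; the piece of [c, c + 1] beyond
    1 is then moved back by one period. *)
Lemma ge0_integral_periodic (f : R -> R) (c : R) :
  measurable_fun setT f -> (forall x, 0 <= f x) -> periodic1 f ->
  (\int[mu]_(x in `[c, (c + 1)%R]) (f x)%:E = \int[mu]_(x in `[0%R, 1%R]) (f x)%:E)%E.
Proof.
move=> mf f0 fp.
have mfE D : measurable D -> measurable_fun D (EFin \o f).
  by move=> mD; apply/measurable_EFinP; exact: measurable_funTS.
have shift (i j : interval R) (k : int) : [set` i] = (+%R^~ k%:~R) @^-1` [set` j] ->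
    (\int[mu]_(x in [set` i]) (f x)%:E = \int[mu]_(x in [set` j]) (f x)%:E)%E.
  move=> ij; rewrite (@ge0_integral_shift k%:~R [set` j])//; last 2 first.
    exact: mfE.
    by move=> x _; rewrite lee_fin.
  by rewrite -ij; apply: eq_integral => x _; rewrite periodic1_int.
pose e := c - (Num.floor c)%:~R.
have e0 : 0 <= e by rewrite subr_ge0 ge_floor.
have e1 : e < 1 by rewrite ltrBlDl -intrD1 floorD1_gt.
have -> : (\int[mu]_(x in `[c, (c + 1)%R]) (f x)%:E =
    \int[mu]_(x in `[e, (e + 1)%R]) (f x)%:E)%E.
  apply/esym/(@shift _ _ (Num.floor c)); apply/seteqP; split => x /=;
    by rewrite /e !in_itv/= => /andP[? ?]; apply/andP; split; lra.
rewrite (@itv_bndbnd_setU _ _ _ (BRight 1)); [|by rewrite bnd_simp; lra..].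
rewrite ge0_integral_setU//=; last 3 first.
- by apply: mfE; exact: measurableU.
- by move=> x _; rewrite lee_fin.
- by apply/disj_setPLR => z /=; rewrite !in_itv/= => /andP[? ?]; apply/negP; rewrite negb_and -leNgt; apply/orP; left.
rewrite (@itv_bndbnd_setU _ _ (BLeft 0) (BRight e) (BRight 1)); [|by rewrite bnd_simp; lra..].
rewrite ge0_integral_setU//=; last 3 first.
- by apply: mfE; exact: measurableU.
- by move=> x _; rewrite lee_fin.
- by apply/disj_setPLR => z /=; rewrite !in_itv/= => /andP[? ?]; apply/negP; rewrite negb_and -leNgt; apply/orP; left.
rewrite addeC; congr (_ + _)%E.
  rewrite -(@shift `]0, e] `]1, (e + 1)] 1); last first.
    by apply/seteqP; split => x /=; rewrite !in_itv/= => /andP[? ?]; apply/andP; split; lra.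
  by rewrite integral_itv_obnd_cbnd//; exact: mfE.
by rewrite integral_itv_obnd_cbnd//; exact: mfE.
Qed.

End periodic_integral.

(** * A Borel version of the initial slope *)

(** A point of discontinuity is an integer translate of 0 or of a point of ]0, 1[
    where continuity fails, so these points lie in a periodic null set N. The
    restriction of f to the complement of N is continuous, hence Borel, and the
    extension by 0 stays periodic. *)
Lemma borel_version (R : realType) (f : R -> R) : periodic1 f ->
  {ae @lebesgue_measure R, forall x, x \in `]0, 1[ -> {for x, continuous f}} ->
  exists N : set R, [/\ measurable N, lebesgue_measure N = 0%E,
    measurable_fun setT (f \_ (~` N)) & periodic1 (f \_ (~` N))].
Proof.
move=> fp [A [mA A0 Acont]].
pose fl (x : R) : R := (Num.floor x)%:~R.
have flP x : 0 <= x - fl x < 1.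
  by rewrite /fl subr_ge0 ge_floor/= ltrBlDl -intrD1 floorD1_gt.
pose N0 := A `|` [set 0].
have mN0 : measurable N0 by exact: measurableU.
have N00 : lebesgue_measure N0 = 0%E.
  by rewrite null_set_setU//; exact: lebesgue_measure_set1.
pose N := [set x : R | N0 (x - fl x)].
have mfl : measurable_fun [set: R] (fun x : R => x - fl x).
  apply: measurable_funB => //; apply: nondecreasing_measurable => // x y xy.
  by rewrite /fl ler_int; exact: le_floor.
have mN : measurable N by rewrite -[N]setTI; exact: mfl.
have cont_frac (x : R) : ~ N0 (x - fl x) -> {for x - fl x, continuous f}.
  move=> Nx; apply: contrapT => nc; apply: Nx.
  have [x0|x0] := eqVneq (x - fl x) 0; first by right.
  left; apply: Acont => /= /(_ _)/nc; apply; rewrite in_itv/= lt_neqAle eq_sym x0/=; exact: flP.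
exists N; split => //.
- pose S (k : int) := (+%R^~ k%:~R) @^-1` N0.
  have mS k : measurable (S k) /\ lebesgue_measure (S k) = 0%E.
    exact: measure_shift_null.
  apply: (@subset_measure0 _ _ _ (@lebesgue_measure R) N (\bigcup_n (S n%:Z `|` S (- n%:Z)))) => //.
  + by apply: bigcupT_measurable => n; apply: measurableU; apply: (mS _).1.
  + move=> x /= Nx; have [k kx] : exists k : int, fl x = k%:~R by exists (Num.floor x).
    move: Nx; rewrite /N/= kx => Nx; exists `|k|%N => //.
    have : k = `|k|%N \/ k = - (`|k|%N)%:Z by case: (intP k) => [|n|n]; [left|left|right]; rewrite ?abszN.
    move=> [kE|kE].
      right; suff : S (- k) x by rewrite {1}kE.
      by rewrite /S /preimage /mkset mulrNz.
    left; suff : S (- k) x by rewrite {1}kE opprK.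
    rewrite /S /preimage /mkset; move: Nx; by rewrite mulrNz.
  + apply/negligibleP; last first.
      by apply: negligible_bigcup => n; apply: negligibleU; apply/negligibleP;
        [exact: (mS _).1|exact: (mS _).2|exact: (mS _).1|exact: (mS _).2].
    by apply: bigcupT_measurable => n; apply: measurableU; apply: (mS _).1.
- apply/(measurable_restrictT _ _).1 => //; first exact: measurableC.
  apply: subspace_continuous_measurable_fun; first exact: measurableC.
  apply: continuous_in_subspaceT => x; rewrite inE /= => Nx.
  have fE : f = f \o (fun y => y - fl x).
    by apply/funext => y /=; rewrite /fl -mulrNz periodic1_int.
  rewrite fE; apply: continuous_comp; last exact: cont_frac.
  by apply: cvgB; [exact: cvg_id|exact: cvg_cst].
- move=> x; rewrite !patchE fp.
  have -> // : (x + 1 \in ~` N) = (x \in ~` N).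
  by apply/idP/idP; rewrite !inE /N /= /fl floorDrz ?rpred1// floor1 intrD opprD addrACA subrr addr0.
Qed.

(** * Sublevel sets and negative powers *)

Section sublevel.
Context (R : realType).
Notation mu := (@lebesgue_measure R).

Lemma near_seq_measure (s : seq R) (rho : R) (B : set R) : 0 <= rho ->
  measurable B -> (forall x, B x -> exists2 a, a \in s & `|x - a| < rho) ->
  (mu B <= ((size s)%:R * (2 * rho))%:E)%E.
Proof.
move=> rho0; elim: s B => [|a s IH] B mB Bs.
  have -> : B = set0 by apply/seteqP; split => // x /Bs[].
  by rewrite measure0 mul0r.
pose B1 := B `\` ball a rho.
have mB1 : measurable B1 by apply: measurableD => //; exact: measurable_ball.
have : (mu B <= mu (ball a rho `|` B1))%E.
  apply: le_measure; rewrite ?inE//; first by apply: measurableU => //; exact: measurable_ball.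
  by move=> x Bx; have [ax|ax] := pselect (ball a rho x); [left|right].
have mball : measurable (ball a rho) by exact: measurable_ball.
move=> /le_trans; apply; have hU := measureU2 (@lebesgue_measure R) mball mB1. apply: (le_trans hU).
have h1 : (mu B1 <= ((size s)%:R * (2 * rho))%:E)%E.
  apply: IH => // x [Bx nax].
  have [b] := Bs _ Bx; rewrite inE => /orP[/eqP -> |bs xb]; last by exists b.
  by rewrite distrC => ?; exfalso; apply: nax.
have -> : ((size (a :: s))%:R * (2 * rho))%:E =
    ((2 * rho)%:E + ((size s)%:R * (2 * rho))%:E)%E.
  by rewrite -EFinD /= -natr1 mulrDl mul1r addrC.
rewrite /= lebesgue_measure_ball//; apply: leeD => //.
by rewrite lee_fin mulr_natl.
Qed.

Lemma uniform_radius (s : seq R) (P : R -> R -> Prop) :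
  (forall a e e', P a e -> 0 < e' -> e' <= e -> P a e') ->
  (forall a, a \in s -> exists2 e, 0 < e & P a e) ->
  exists2 e, 0 < e & forall a, a \in s -> P a e.
Proof.
move=> Pe; elim: s => [|a s IH] sP; first by exists 1.
have [e e0 aP] := sP a (mem_head _ _).
have [b bs|e' e'0 IHe] := IH; first by apply: sP; rewrite inE bs orbT.
have m0 : 0 < Num.min e e' by rewrite lt_min e0.
exists (Num.min e e') => // b; rewrite inE => /orP[/eqP ->|bs].
  by apply: Pe aP _ _ => //; rewrite ge_min lexx.
by apply: Pe (IHe _ bs) _ _ => //; rewrite ge_min lexx orbT.
Qed.

Variables (f : R -> R) (m0 C2 q : R).
Hypotheses (q0 : 0 < q) (C20 : 0 < C2) (fper : periodic1 f).
Hypothesis fmin : negative_minimum f m0.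
Hypothesis forder : forall a, f a = m0 -> min_order f m0 C2 q a.

(** The ratio in [min_order] tends to 1, hence lies in [1/2, 2] near a. *)
Lemma min_order_bounds a : f a = m0 -> exists2 e, 0 < e & forall x,
  x != a -> `|x - a| < e ->
  C2 / 2 * `|x - a| `^ q <= f x - m0 <= 2 * C2 * `|x - a| `^ q.
Proof.
move=> /forder /cvgrPdist_lt/(_ (1/2)).
have h : 0 < 1 / 2 :> R by lra.
move=> /(_ h) /nbhs_ballP[e /= e0 He]; exists e => // x xa xe.
have := He x; rewrite /ball/= distrC => /(_ xe xa).
have p0 : 0 < C2 * `|x - a| `^ q.
  by rewrite mulr_gt0// powR_gt0// normr_gt0 subr_eq0.
set y := (f x - m0) / _ => Hy.
have -> : f x - m0 = y * (C2 * `|x - a| `^ q) by rewrite /y divfK// gt_eqF.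
have /andP[y1 y2] : 1/2 <= y <= 2.
  by move: Hy; rewrite ltr_norml => /andP[? ?]; apply/andP; split; lra.
apply/andP; split.
  have -> : C2 / 2 * `|x - a| `^ q = 1/2 * (C2 * `|x - a| `^ q) by field.
  by rewrite ler_pM2r.
by rewrite -mulrA ler_pM2r.
Qed.

(** By [min_away] a point where f is close to m0 is close to a minimum point a,
    possibly outside the period; a is an integer translate, by at most 1, of one
    of the finitely many minimum points in [0, 1], which share a common radius for
    [min_order_bounds]. *)
Lemma near_minimum : exists s : seq R, exists2 d : R, 0 < d &
  forall x, 0 <= x <= 1 -> f x - m0 < d ->
    exists2 a, a \in s & C2 / 2 * `|x - a| `^ q <= f x - m0.
Proof.
have [s sE] := (finite_seqP _).1 (min_finite fmin).
have sP a : (a \in s) = (0 <= a <= 1) && (f a == m0).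
  have : [set` s] a <-> [set x | 0 <= x <= 1 /\ f x = m0] a by rewrite sE.
  move=> /= sP; apply/idP/andP.
    by move=> /sP[? ->].
  by move=> [? /eqP ?]; apply/sP.
pose P a e := e <= 1 /\ forall x,
  `|x - a| < e -> C2 / 2 * `|x - a| `^ q <= f x - m0.
have [|a|e e0 eP] := @uniform_radius s P.
- move=> a e e' [e1 He] e'0 ee'; split; first exact: le_trans e1.
  by move=> x xa; apply: He; exact: lt_le_trans ee'.
- rewrite sP => /andP[_ /eqP fa]; have [e e0 He] := min_order_bounds fa.
  exists (Num.min e 1); first by rewrite lt_min e0 ltr01.
  split; first by rewrite ge_min lexx orbT.
  move=> x; rewrite lt_min => /andP[xe _].
  have [->|xa] := eqVneq x a; last by have /andP[] := He x xa xe.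
  by rewrite fa !subrr normr0 powR0 ?gt_eqF// mulr0.
have [d d0 dP] := min_away fmin e0.
pose sh := [seq a + k | a <- s, k <- [:: -1; 0; 1]].
exists sh, d => // x /andP[x0 x1] xd.
have [a fa xa] : exists2 a, f a = m0 & `|x - a| < e.
  apply: contrapT => nex; have := dP x; rewrite leNgt; move/(_ _)/negP; apply; last by lra.
  by move=> a fa; rewrite leNgt; apply/negP => xa; apply: nex; exists a.
pose k := Num.floor a; pose a' := a - k%:~R.
have a'0 : 0 <= a' by rewrite subr_ge0 ge_floor.
have a'1 : a' < 1 by rewrite ltrBlDl -intrD1 floorD1_gt.
have a's : a' \in s.
  by rewrite sP a'0 ltW//= /a' -mulrNz periodic1_int// fa.
have [e1 _] := eP _ a's.
have k1 : (-2 < k%:~R :> R) /\ (k%:~R < 2 :> R).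
  move: xa; rewrite ltr_norml => /andP[? ?].
  by rewrite /a' in a'0 a'1; split; lra.
exists a.
  have -> : a = a' + k%:~R by rewrite /a' subrK.
  apply/allpairsP; exists (a', k%:~R) => /=; split => //.
  have [k3 k4] : (-2 < k) /\ (k < 2) :> Prop.
    by move: k1 => [k3 k4]; rewrite -!(ltr_int R) mulrNz; split; lra.
  by case: (k) k3 k4 => [[|[|?]]|[|?]] // _ _; rewrite !inE ?eqxx ?orbT.
have := (eP _ a's).2 (x - k%:~R).
have -> : x - k%:~R - a' = x - a by rewrite /a'; ring.
by move=> /(_ xa); rewrite -mulrNz periodic1_int.
Qed.

(** For small d the sublevel set is covered by finitely many intervals whose
    length is of order d^(1/q), by the lower bound of [near_minimum]; for the other
    values of d the measure is at most 1. On N the function vanishes, which is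
    above m0, so these points do not enter small sublevel sets. *)
Lemma sublevel_measure (N : set R) : measurable_fun setT (f \_ (~` N)) ->
  exists2 C : R, 0 <= C & forall d, 0 < d ->
  (mu (`[0%R, 1%R]%classic `&` [set x | ((f \_ (~` N)) x - m0 < d)%R])
     <= (C * d `^ q^-1)%:E)%E.
Proof.
move=> mg; have m00 := min_lt0 fmin.
have [s [d d0 sP]] := near_minimum.
(* below - m0, sublevel sets do not meet N, where the function is 0 *)
pose d1 := Num.min d (- m0).
have d10 : 0 < d1 by rewrite lt_min d0 oppr_gt0.
have qV0 : 0 < q^-1 by rewrite invr_gt0.
pose K := (size s)%:R * (2 * (2 / C2) `^ q^-1).
have K0 : 0 <= K by rewrite !mulr_ge0// powR_ge0.
exists (K + (d1 `^ q^-1)^-1); first by rewrite addr_ge0// invr_ge0 powR_ge0.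
move=> e e0; set A := _ `&` _.
have mA : measurable A.
  apply: measurableI => //; rewrite -[X in measurable X]setTI.
  rewrite (_ : [set x | _] = (fun x => (f \_ (~` N)) x - m0) @^-1` `]-oo, e[%classic).
    have : measurable_fun setT (fun x => (f \_ (~` N)) x - m0) by exact: measurable_funB.
    by apply.
  by apply/seteqP; split => x /=; rewrite in_itv.
have eq0 : 0 <= e `^ q^-1 by rewrite powR_ge0.
have [ed|de] := leP e d1; last first.
  apply: (@le_trans _ _ 1%E).
    rewrite -[leRHS](_ : mu `[0%R, 1%R]%classic = 1%E).
      by apply: le_measure; rewrite ?inE //; exact: subIsetl.
    by rewrite lebesgue_measure_itv/= lte_fin ltr01 oppr0 adde0.
  rewrite lee_fin mulrDl -[leLHS]add0r; apply: lerD; first by rewrite mulr_ge0.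
  rewrite mulrC ler_pdivlMr ?powR_gt0// mul1r.
  by apply: ge0_ler_powR; rewrite ?nnegrE ltW.
pose rho := (2 / C2 * e) `^ q^-1.
apply: (le_trans (@near_seq_measure s rho A _ mA _)); first by rewrite powR_ge0.
  move=> x [/= x01 xe].
  have {}xe : f x - m0 < e.
    move: xe; rewrite patchE; case: ifPn => // _.
    by move=> h; exfalso; move: h ed; rewrite /d1 le_min => h /andP[_ ?]; rewrite /point/= in h; lra.
  have xd : f x - m0 < d.
    by rewrite (lt_le_trans xe)// (le_trans ed)// /d1 ge_min lexx.
  rewrite in_itv/= in x01; have [a as_ aP] := sP x x01 xd.
  exists a => //; rewrite ltNge; apply/negP => rx.
  have : rho `^ q <= `|x - a| `^ q.
    by apply: ge0_ler_powR => //; rewrite ?nnegrE ?powR_ge0 ?ltW.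
  rewrite /rho -powRrM mulVf ?gt_eqF// powRr1; last first.
    by rewrite !mulr_ge0// ?ltW// invr_gt0.
  rewrite -(ler_pM2l (_ : 0 < C2 / 2)); last by rewrite divr_gt0.
  have -> : C2 / 2 * (2 / C2 * e) = e by field; rewrite gt_eqF.
  by move=> h; move: aP xe h; lra.
rewrite lee_fin /rho powRM//; [|by rewrite divr_ge0// ltW|exact: ltW].
rewrite [leRHS]mulrDl (_ : _ * (2 * _) = K * e `^ q^-1); last by rewrite /K; ring.
by rewrite lerDl mulr_ge0// invr_ge0 powR_ge0.
Qed.

End sublevel.

Section layer_cake.
Context (R : realType).
Notation mu := (@lebesgue_measure R).
Variables (w : R -> R) (D : set R) (C kappa : R).
Hypotheses (mD : measurable D) (mw : measurable_fun setT w) (w0 : forall x, 0 <= w x).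
Hypotheses (C0 : 0 <= C) (kappa0 : 0 < kappa) (Doo : (mu D < +oo)%E).
Hypothesis sub : forall d, 0 < d ->
  (mu (D `&` [set x | (w x < d)%R]) <= (C * d `^ kappa)%:E)%E.

(** Layer cake over dyadic levels: w^(- r) is at most 1 plus the sum of the
    2^(n + 1) over the n such that w^(- r) > 2^n. The hypothesis bounds the measure
    of that level by a multiple of 2^(- n kappa / r), which makes the series
    geometric with ratio 2^(1 - kappa / r) < 1. At the zeros of w the bound holds
    because a negative power of 0 is 0 by convention. *)
Lemma integral_negative_power (r : R) : 0 < r < kappa ->
  (\int[mu]_(x in D) (w x `^ (- r))%:E < +oo)%E.
Proof.
move=> /andP[r0 rk].
pose th n := (2 ^+ n) `^ (- r^-1) : R.
have th0 n : 0 < th n by rewrite powR_gt0// exprn_gt0.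
pose A n := [set x | w x < th n].
have mA n : measurable (A n).
  rewrite -[X in measurable X]setTI (_ : A n = w @^-1` `]-oo, th n[%classic).
    exact: mw.
  by apply/seteqP; split => x /=; rewrite /A in_itv.
pose t n x := (2 ^+ n.+1 * \1_(A n) x)%:E : \bar R.
have t0 n x : (0 <= t n x)%E by rewrite lee_fin mulr_ge0// exprn_ge0.
have mt n E : measurable_fun E (t n).
  by apply/measurable_EFinP/measurable_funM.
have mind n E : measurable_fun E (fun x => (\1_(A n) x)%:E : \bar R).
  exact/measurable_EFinP.
have tS x : (0 <= \sum_(n <oo) t n x)%E by exact: nneseries_ge0.
have mtS : measurable_fun D (fun x => \sum_(n <oo) t n x)%E.
  by apply: (@ge0_emeasurable_sum _ _ _ D t xpredT).
have dom x : ((w x `^ (- r))%:E <= 1 + \sum_(n <oo) t n x)%E.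
  have [->|wx] := eqVneq (w x) 0.
    by rewrite powR0 ?adde_ge0// oppr_eq0 gt_eqF.
  have {}wx : 0 < w x by rewrite lt_neqAle eq_sym wx w0.
  pose y := w x `^ (- r); rewrite -/y.
  have [y1|y1] := leP y 1; first by rewrite -[leLHS]adde0 leeD// lee_fin.
  have ex : exists n, y <= 2 ^+ n.
    exists (Num.truncn y).+1; apply/ltW/(lt_trans (truncnS_gt y)).
    by rewrite -natrX ltr_nat ltn_expl.
  (* the least n.+1 with w x `^ (- r) <= 2 ^+ n.+1 gives the level that is used *)
  case: (ex_minnP ex) => -[|n]; first by rewrite expr0 leNgt y1.
  move=> yn nmin.
  have ny : 2 ^+ n < y by rewrite ltNge; apply/negP => /nmin; rewrite ltnn.
  have An : A n x.
    rewrite /A/=; have -> : w x = y `^ (- r^-1).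
      by rewrite /y -powRrM mulrNN divff ?gt_eqF// powRr1 ?ltW.
    have h : (2 ^+ n) `^ r^-1 < y `^ r^-1.
      by apply: gt0_ltr_powR => //; rewrite ?invr_gt0 ?nnegrE ?exprn_ge0 ?powR_ge0.
    by rewrite /th !powRN ltf_pV2// posrE powR_gt0 ?exprn_gt0// /y powR_gt0.
  apply: (@le_trans _ _ (t n x)).
    by rewrite /t indicE mem_set// mulr1 lee_fin.
  apply: (@le_trans _ _ (\sum_(n <oo) t n x)%E); last by rewrite leeDr.
  rewrite (@nneseriesD1 _ _ n)//=.
  by rewrite leeDl// nneseries_ge0.
apply: (@le_lt_trans _ _ (\int[mu]_(x in D) (1 + \sum_(n <oo) t n x))%E).
  apply: ge0_le_integral => //.
  - by move=> x _; rewrite lee_fin powR_ge0.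
  - apply/measurable_EFinP; apply: (measurableT_comp (measurable_powR _)).
    exact: measurable_funTS.
  - exact: emeasurable_funD.
rewrite ge0_integralD//.
rewrite integral_cst// mul1e lte_add_pinfty//.
rewrite integral_nneseries//; last by move=> n; exact: mt.
pose x := 2 * 2 `^ (- (kappa / r)) : R.
have x0 : 0 < x by rewrite mulr_gt0// powR_gt0.
have x1 : x < 1.
  have a0 : 0 < kappa / r - 1 by rewrite subr_gt0 ltr_pdivlMr// mul1r.
  have -> : x = (2 `^ (kappa / r - 1))^-1.
    by rewrite -powRN opprB powRD ?powRr1// pnatr_eq0 implybT.
  have := @gt0_ltr_powR R _ a0 1 2; rewrite powR1 !nnegrE => h.
  by rewrite invf_lt1 ?powR_gt0// h// ltr1n.
apply: (@le_lt_trans _ _ (2 * C / (1 - x))%:E); last exact: ltry.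
apply: lime_le; first by apply: is_cvg_nneseries => n _ _; exact: integral_ge0.
apply: nearW => n.
apply: (@le_trans _ _ (\sum_(0 <= i < n) (2 * C * x ^+ i)%:E)%E).
  apply: lee_sum => i _.
  rewrite /t; under eq_integral do rewrite EFinM.
  rewrite ge0_integralZl_EFin//; last exact: mind.
  have subA : (mu (A i `&` D) <= (C * th i `^ kappa)%:E)%E.
    by rewrite setIC; exact: sub.
  rewrite integral_indic//; last exact: mA.
  apply: (@le_trans _ _ ((2 ^+ i.+1)%:E * (C * th i `^ kappa)%:E)%E).
    by rewrite lee_pmul2l// ?lte_fin ?exprn_gt0.
  rewrite -EFinM lee_fin exprS /x exprMn.
  rewrite (_ : th i `^ kappa = (2 `^ (- (kappa / r))) ^+ i); first by lra.
  rewrite /th -!powRrM -powR_mulrn// -powRrM -[RHS]powR_mulrn ?powR_ge0// -powRrM.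
  by congr (_ `^ _); ring.
rewrite sumEFin lee_fin.
have -> : \sum_(0 <= i < n) 2 * C * x ^+ i = series (geometric (2 * C) x) n by [].
rewrite geometric_seriesE ?(lt_eqF x1)//=.
by rewrite ler_pM2r ?invr_gt0 ?subr_gt0// ler_piMr ?mulr_ge0// gerBl exprn_ge0 ?ltW.
Qed.

Lemma integral_sublevel_power (s B : R) : - kappa < s -> (forall x, D x -> w x <= B) ->
  mu.-integrable D (fun x => (w x `^ s)%:E).
Proof.
move=> ks wB.
have mws : measurable_fun D (fun x => (w x `^ s)%:E).
  apply/measurable_EFinP; apply: (measurableT_comp (measurable_powR _)).
  exact: measurable_funTS.
apply/integrableP; split => //.
under eq_integral do rewrite gee0_abs ?lee_fin ?powR_ge0//.
have [s0|s0] := leP 0 s; last first.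
  by rewrite -(opprK s) integral_negative_power//; apply/andP; split; lra.
apply: (@le_lt_trans _ _ (\int[mu]_(x in D) (B `^ s)%:E)%E).
  apply: ge0_le_integral => //.
  - by move=> x _; rewrite lee_fin powR_ge0.
  - move=> x Dx; rewrite lee_fin; apply: ge0_ler_powR => //; last exact: wB.
      by rewrite nnegrE.
    by rewrite nnegrE (le_trans (w0 x))// wB.
by rewrite integral_cst// lte_mul_pinfty// lee_fin powR_ge0.
Qed.

End layer_cake.

(** * Limits of powers and of parametric integrals *)

Section powR_limits.
Context (R : realType).

Lemma cvg_powR (T : Type) (F : set_system T) {FF : Filter F} (f : T -> R) (l r : R) :
  0 < l -> f x @[x --> F] --> l -> f x `^ r @[x --> F] --> l `^ r.
Proof.
move=> l0 fl; have : {for l, continuous (fun x : R => x `^ r)}.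
  apply/differentiable_continuous/derivable1_diffP/derivable_powR.
  by rewrite in_itv/= andbT.
move=> h; have h2 : (fun x : R => x `^ r) x @[x --> l] --> l `^ r := h.
exact: (cvg_comp _ _ fl h2).
Qed.

Lemma cvg_powR_ge0 (T : Type) (F : set_system T) {FF : Filter F} (f : T -> R) (l r : R) :
  0 < r -> (forall x, 0 <= f x) -> 0 <= l ->
  f x @[x --> F] --> l -> f x `^ r @[x --> F] --> l `^ r.
Proof.
move=> r0 f0 + fl; rewrite le_eqVlt => /predU1P[l0|l0]; last exact: cvg_powR.
rewrite -l0 powR0 ?gt_eqF//; apply/cvgrPdist_lt => e e0.
have er0 : 0 < e `^ r^-1 by rewrite powR_gt0.
move/cvgrPdist_lt : fl => /(_ _ er0); apply: filterS => x.
rewrite -l0 !sub0r !normrN !ger0_norm ?powR_ge0// => fx.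
have := @gt0_ltr_powR R r r0 (f x) (e `^ r^-1).
by rewrite !nnegrE f0 powR_ge0 -powRrM mulVf ?gt_eqF// powRr1 ?ltW//; apply.
Qed.

End powR_limits.

Section integral_continuity.
Context (R : realType).
Notation mu := (@lebesgue_measure R).

Lemma ae_off_null (N : set R) (Q : R -> Prop) : measurable N -> mu N = 0%E ->
  (forall x, ~ N x -> Q x) -> {ae mu, forall x, Q x}.
Proof.
move=> mN N0 NQ; exists N; split => // x /= nQ; apply: contrapT => Nx.
by apply: nQ; exact: NQ.
Qed.

(** Dominated convergence along sequences. Replacing f h by f a for h outside P
    turns the limit within P into an ordinary one, to which the sequential
    characterization of limits applies. *)
Lemma continuity_integral_within (D N P : set R) (a : R) (f : R -> R -> R)
    (dom : R -> R) : measurable D -> measurable N -> mu N = 0%E -> P a ->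
  (forall h, P h -> measurable_fun D (f h)) ->
  mu.-integrable D (EFin \o dom) ->
  (forall x, D x -> ~ N x -> forall h, P h -> `|f h x| <= dom x) ->
  (forall x, D x -> ~ N x -> f h x @[h --> within P (nbhs a)] --> f a x) ->
  (\int[mu]_(x in D) f h x) @[h --> within P (nbhs a)] -->
    \int[mu]_(x in D) f a x.
Proof.
move=> mD mN N0 Pa mf idom fdom fa.
pose f' h := if pselect (P h) then f h else f a.
have Pf' h : P h -> f' h = f h by rewrite /f'; case: pselect.
suff : (\int[mu]_(x in D) f' h x) @[h --> a] --> \int[mu]_(x in D) f a x.
  move=> f'a; apply: cvg_trans (cvg_within_filter P f'a).
  by apply: near_eq_cvg; rewrite near_withinE; apply: nearW => h Ph; rewrite Pf'.
apply/(@cvg_nbhsP R R^o) => u ua.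
have mf' h : measurable_fun D (f' h) by rewrite /f'; case: pselect => Ph; exact: mf.
have [] := @dominated_convergence _ _ _ mu D mD (fun n => EFin \o f' (u n))
  (EFin \o f a) (EFin \o dom) _ _ _ idom _.
- by move=> n; apply/measurable_EFinP; exact: mf'.
- by apply/measurable_EFinP; exact: mf.
- apply: (ae_off_null mN N0) => x Nx Dx; apply: cvg_EFin; first exact: nearW.
  have f'a : f' h x @[h --> a] --> f a x.
    apply/cvgrPdist_lt => e e0; move/cvgrPdist_lt: (fa _ Dx Nx) => /(_ e e0).
    rewrite near_withinE; apply: filterS => h he; rewrite /f'.
    by case: pselect => Ph; [exact: he|rewrite subrr normr0].
  by have := @cvg_comp _ _ _ u (fun h => f' h x) _ _ _ ua f'a; apply: cvg_trans.
- apply: (ae_off_null mN N0) => x Nx n Dx; rewrite lee_fin /f'.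
  by case: pselect => Ph; exact: (fdom x Dx Nx).
- move=> fin0 _ h; apply: fine_cvg.
  by rewrite fineK// integrable_fin_num.
Qed.

End integral_continuity.

(** * Integrals of a function with small sublevel sets *)

Lemma cvg_within_at_left1 (R : realType) (f : R -> R) (l : R) :
  f e @[e --> within `[0%R, 1%R]%classic (nbhs (1 : R))] --> l ->
  f e @[e --> (1 : R)^'-] --> l.
Proof.
have e0 : \forall e \near (1 : R), (0 : R) < e by apply: lt_nbhsr; exact: ltr01.
move=> fl; apply: cvg_trans fl; apply: cvg_app => A fA.
apply: filterS2 e0 fA => e e0 fA e1; apply: fA.
by rewrite /= in_itv/= !ltW.
Qed.

(** Abstraction of J at the blow-up value of eta: only its range and the size of
    its sublevel sets matter for the integrals below. *)
Record profile (R : realType) (w : R -> R) (B C kappa : R) : Prop := Profile {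
  prof_measurable : measurable_fun setT w;
  prof_ge0 : forall x, 0 <= w x;
  prof_leB : forall x, w x <= B;
  prof_ge1 : 1 <= B;
  prof_C : 0 <= C;
  prof_kappa : 0 < kappa;
  prof_sublevel : forall d, 0 < d ->
    (@lebesgue_measure R (`[0%R, 1%R]%classic `&` [set x | (w x < d)%R])
       <= (C * d `^ kappa)%:E)%E
}.

Section profile.
Context (R : realType).
Notation mu := (@lebesgue_measure R).
Local Notation I01 := (`[0%R : R, 1%R : R]%classic).
Variables (w : R -> R) (B C kappa : R).
Hypothesis hw : profile w B C kappa.

Let mw := prof_measurable hw.
Let w0 := prof_ge0 hw.
Let wB := prof_leB hw.
Let B1 := prof_ge1 hw.
Let C0 := prof_C hw.
Let kappa0 := prof_kappa hw.
Let sub := prof_sublevel hw.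

(** With w = J(., eta_star), this is J(., e * eta_star). *)
Definition Jmix (e x : R) : R := 1 - e + e * w x.
Definition Kmix (r e : R) : R := \int[mu]_(x in I01) (Jmix e x `^ r).
Definition zeros : set R := I01 `&` [set x | w x <= 0].

Let muI : mu I01 = 1%E.
Proof. by rewrite lebesgue_measure_itv/= lte_fin ltr01 oppr0 adde0. Qed.

Let muIoo : (mu I01 < +oo)%E.
Proof. by rewrite muI ltry. Qed.

Let mI : measurable I01.
Proof. exact: measurable_itv. Qed.

Lemma measurable_sublevel d : measurable [set x | w x < d].
Proof.
rewrite -[X in measurable X]setTI (_ : [set x | w x < d] = w @^-1` `]-oo, d[%classic).
  exact: mw.
by apply/seteqP; split => x /=; rewrite in_itv.
Qed.

Lemma small_sublevel (t : R) : 0 < t -> exists2 d, 0 < d <= 1 &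
  (mu (I01 `&` [set x | (w x < d)%R]) <= t%:E)%E.
Proof.
move=> t0; (* C + 1 instead of C, as C may vanish *)
pose d := Num.min 1 ((t / (C + 1)) `^ kappa^-1).
have C10 : 0 < C + 1 by rewrite ltr_wpDl.
have d0 : 0 < d by rewrite lt_min ltr01 powR_gt0// divr_gt0.
exists d; first by rewrite d0 ge_min lexx.
apply: (le_trans (sub d0)); rewrite lee_fin.
have : d `^ kappa <= t / (C + 1).
  have h : d <= (t / (C + 1)) `^ kappa^-1 by rewrite ge_min lexx orbT.
  have := @ge0_ler_powR R kappa (ltW kappa0) d ((t / (C + 1)) `^ kappa^-1).
  rewrite !nnegrE ltW// powR_ge0 => /(_ isT isT h).
  by rewrite -powRrM mulVf ?gt_eqF// powRr1// divr_ge0// ltW.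
move=> /(ler_wpM2l C0) /le_trans; apply.
rewrite mulrA ler_pdivrMr// mulrC ler_pM2l//.
by rewrite lerDl.
Qed.

Lemma measurable_zeros : measurable zeros.
Proof.
apply: measurableI => //.
rewrite -[X in measurable X]setTI (_ : [set x | w x <= 0] = w @^-1` `]-oo, 0]%classic).
  exact: mw.
by apply/seteqP; split => x /=; rewrite in_itv.
Qed.

Lemma measure_zeros : mu zeros = 0%E.
Proof.
apply/eqP; rewrite -measure_le0; apply/lee_addgt0Pr => t t0; rewrite add0e.
have [d /andP[d0 _] dt] := small_sublevel t0; apply: le_trans dt.
apply: le_measure; rewrite ?inE.
- exact: measurable_zeros.
- by apply: measurableI => //; exact: measurable_sublevel.
- by move=> x [x01 /= wx]; split => //=; exact: le_lt_trans d0.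
Qed.

Lemma off_zeros x : I01 x -> ~ zeros x -> 0 < w x.
Proof. by move=> Ix zx; rewrite ltNge; apply/negP => wx; apply: zx. Qed.

Lemma Jmix_ge0 e x : 0 <= e <= 1 -> 0 <= Jmix e x.
Proof. by move=> /andP[e0 e1]; rewrite addr_ge0 ?subr_ge0 ?mulr_ge0. Qed.

Lemma Jmix_ge (e x : R) : 0 <= e <= 1 -> 1 - e <= Jmix e x.
Proof. by move=> /andP[e0 e1]; rewrite lerDl mulr_ge0. Qed.

Lemma Jmix_leB (e x : R) : 0 <= e <= 1 -> Jmix e x <= B.
Proof.
move=> /andP[e0 e1]; have := wB x; move: (w0 x) B1; rewrite /Jmix.
by nra.
Qed.

(** A convex combination of 1 and w x. *)
Lemma Jmix_min (e x : R) : 0 <= e <= 1 -> Num.min 1 (w x) <= Jmix e x.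
Proof.
by move=> /andP[e0 e1]; rewrite /Jmix minEle; case: ifPn => h; have := w0 x; [|move: h; rewrite -ltNge]; nra.
Qed.

Lemma Jmix_gt0 e x : 0 <= e <= 1 -> 0 < w x -> 0 < Jmix e x.
Proof. by move=> e01 wx; apply: lt_le_trans (Jmix_min _ e01); rewrite lt_min ltr01. Qed.

Lemma measurable_Jmix e (D : set R) : measurable_fun D (Jmix e).
Proof.
apply: measurable_funTS; apply: measurable_funD => //.
by apply: measurable_funM.
Qed.

Lemma measurable_Jmix_powR e r (D : set R) :
  measurable_fun D (fun x => Jmix e x `^ r).
Proof.
by apply: (measurableT_comp (measurable_powR _)); exact: measurable_Jmix.
Qed.

Lemma ler_powR_npos (x y r : R) : 0 < x -> x <= y -> r <= 0 -> y `^ r <= x `^ r.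
Proof.
move=> x0 xy r0; rewrite -(opprK r) !(powRN _ (- r)).
rewrite lef_pV2 ?posrE ?powR_gt0 ?(lt_le_trans x0 xy)//.
by rewrite ge0_ler_powR ?oppr_ge0 ?nnegrE// ltW// (lt_le_trans x0 xy).
Qed.

(** A bound for the r-th power of [Jmix] that is uniform in e: the power is largest
    at one of the two ends of [min(1, w x), B], according to the sign of r. *)
Definition dom (r x : R) : R := 1 + w x `^ r + B `^ r.

Lemma Jmix_le_dom (r e x : R) : 0 <= e <= 1 -> 0 < w x -> Jmix e x `^ r <= dom r x.
Proof.
move=> e01 wx; have J0 := Jmix_gt0 e01 wx; rewrite /dom.
have [r0|r0] := leP 0 r.
  apply: (@le_trans _ _ (B `^ r)); last by rewrite lerDr addr_ge0// powR_ge0.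
  by rewrite ge0_ler_powR ?nnegrE ?Jmix_leB ?(ltW J0) ?(le_trans ler01 B1).
have B0 := powR_ge0 B r; have wr0 := powR_ge0 (w x) r.
have := Jmix_min x e01; rewrite minEle; case: ifPn => _ h.
  have := ler_powR_npos ltr01 h (ltW r0); rewrite powR1 => hh.
  by lra.
by have := ler_powR_npos wx h (ltW r0); lra.
Qed.

Let integrable_Wpow (r : R) : - kappa < r -> mu.-integrable I01 (fun x => (w x `^ r)%:E).
Proof.
move=> kr; exact: (@integral_sublevel_power R w I01 C kappa mI mw w0 C0 muIoo sub
  r B kr (fun x _ => wB x)).
Qed.

Lemma integrable_dom (r : R) : - kappa < r -> mu.-integrable I01 (EFin \o dom r).
Proof.
move=> kr.
have iw := integrable_Wpow kr.
have ic (c : R) : mu.-integrable I01 (fun=> c%:E).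
  apply: (@measurable_bounded_integrable _ _ _ mu (fun=> c)) => //.
  by exists `|c|; split; [exact: num_real|move=> z /ltW zc y _].
rewrite (_ : _ \o _ = (fun x => (1%:E + (w x `^ r)%:E) + (B `^ r)%:E)%E)//.
by apply: integrableD => //; apply: integrableD.
Qed.

(** For e < 1, [Jmix] is bounded away from 0. *)
Lemma integrable_Jmix_lt (r e : R) : 0 <= e < 1 ->
  mu.-integrable I01 (fun x => (Jmix e x `^ r)%:E).
Proof.
move=> /andP[e0 e1]; have e01 : 0 <= e <= 1 by rewrite e0 ltW.
have d0 : 0 < 1 - e by rewrite subr_gt0.
apply: measurable_bounded_integrable => //; first exact: measurable_Jmix_powR.
exists ((1 - e) `^ r + B `^ r); split; first exact: num_real.
move=> z /ltW zM x _; apply: le_trans zM; rewrite ger0_norm ?powR_ge0//.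
have := Jmix_ge x e01; have JB := Jmix_leB x e01.
have := powR_ge0 B r; have := powR_ge0 (1 - e) r => ? ? Je.
have [r0|r0] := leP 0 r.
  have : Jmix e x `^ r <= B `^ r.
    by rewrite ge0_ler_powR ?nnegrE ?(Jmix_ge0 x e01) ?(le_trans ler01 B1).
  by lra.
by have := ler_powR_npos d0 Je (ltW r0); lra.
Qed.

Lemma integrable_Jmix (r e : R) : - kappa < r -> 0 <= e <= 1 ->
  mu.-integrable I01 (fun x => (Jmix e x `^ r)%:E).
Proof.
move=> kr /[dup] e01 /andP[e0 e1].
have [->|en1] := eqVneq e 1.
  apply: eq_integrable (integrable_Wpow kr) => // x _.
  by rewrite /Jmix subrr add0r mul1r.
by apply: integrable_Jmix_lt; rewrite e0 lt_neqAle en1.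
Qed.

Lemma Jmix_cvg (x a : R) : Jmix e x @[e --> within I01 (nbhs a)] --> Jmix a x.
Proof.
apply: cvg_within_filter; apply: cvgD.
  by apply: cvgB; [exact: cvg_cst|exact: cvg_id].
by apply: cvgMl; exact: cvg_id.
Qed.

Lemma Kmix_cvg (r a : R) : - kappa < r -> 0 <= a <= 1 ->
  Kmix r (e : R) @[e --> within I01 (nbhs a)] --> Kmix r a.
Proof.
move=> kr a01; apply: (@continuity_integral_within R I01 zeros I01 a
   (fun e x => Jmix e x `^ r) (dom r)) => //.
- exact: measurable_zeros.
- exact: measure_zeros.
- by move=> e _; exact: measurable_Jmix_powR.
- exact: integrable_dom.
- move=> x Ix zx e /=; rewrite in_itv/= => e01.
  by rewrite ger0_norm ?powR_ge0// Jmix_le_dom// off_zeros.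
- move=> x Ix zx; apply: cvg_powR; first exact/Jmix_gt0/off_zeros.
  exact: Jmix_cvg.
Qed.

Lemma Kmix_EFin (r e : R) : - kappa < r -> 0 <= e <= 1 ->
  (\int[mu]_(x in I01) (Jmix e x `^ r)%:E = (Kmix r e)%:E)%E.
Proof.
by move=> kr e01; rewrite /Kmix /Rintegral fineK// integrable_fin_num// integrable_Jmix.
Qed.

Lemma Kmix_ge0 r e : 0 <= Kmix r e.
Proof. by apply: Rintegral_ge0 => x _; rewrite powR_ge0. Qed.

Lemma Kmix_bounded (r : R) : - kappa < r -> exists M : R, forall e, 0 <= e <= 1 -> Kmix r e <= M.
Proof.
move=> kr; exists (\int[mu]_(x in I01) (dom r x)) => e e01.
rewrite -lee_fin -Kmix_EFin// /Rintegral fineK; last first.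
  by rewrite integrable_fin_num// integrable_dom.
apply: ae_ge0_le_integral => //.
- by move=> x _; rewrite lee_fin powR_ge0.
- by apply/measurable_EFinP; exact: measurable_Jmix_powR.
- by move=> x _; rewrite lee_fin !addr_ge0// powR_ge0.
- exact: (measurable_int _ (integrable_dom kr)).
- apply: (ae_off_null measurable_zeros measure_zeros) => x zx Ix.
  by rewrite lee_fin Jmix_le_dom// off_zeros.
Qed.

(** On a set of measure at least 1/2 the function w is bounded away from 0, hence
    so is [Jmix], uniformly in e. *)
Lemma Kmix_lower (b : R) : 0 <= b -> exists2 c, 0 < c & forall e, 0 <= e <= 1 -> c <= Kmix b e.
Proof.
move=> b0; have kb : - kappa < b by rewrite (lt_le_trans _ b0)// oppr_lt0.
have h2 : 0 < 2^-1 :> R by rewrite invr_gt0.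
have [d /andP[d0 d1] hd] := small_sublevel h2.
exists (d `^ b / 2); first by rewrite divr_gt0// powR_gt0.
move=> e e01; rewrite -lee_fin -Kmix_EFin//.
set A := I01 `&` [set x | (w x < d)%R] in hd.
have mA : measurable A by apply: measurableI => //; exact: measurable_sublevel.
apply: (@le_trans _ _ (\int[mu]_(x in I01 `\` A) (d `^ b)%:E)%E); last first.
  apply: (@le_trans _ _ (\int[mu]_(x in I01 `\` A) (Jmix e x `^ b)%:E)%E).
    apply: ge0_le_integral => //.
    - exact: measurableD.
    - by move=> x _; rewrite lee_fin powR_ge0.
    - by apply/measurable_EFinP; exact: measurable_Jmix_powR.
    - move=> x [Ix Ax]; rewrite lee_fin.
      have dw : d <= w x by rewrite leNgt; apply/negP => wd; apply: Ax.
      have dJ : d <= Jmix e x.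
        by apply: le_trans (Jmix_min _ e01); rewrite le_min d1.
      by rewrite ge0_ler_powR// nnegrE ?(ltW d0) ?(Jmix_ge0 x e01).
  apply: ge0_subset_integral => //.
  - exact: measurableD.
  - by apply/measurable_EFinP; exact: measurable_Jmix_powR.
  - by move=> x _; rewrite lee_fin powR_ge0.
rewrite integral_cst//; last exact: measurableD.
rewrite EFinM lee_pmul2l ?lte_fin ?powR_gt0//.
have -> : (2^-1)%:E = (1 - (2^-1)%:E)%E :> \bar R.
  by rewrite -EFinB; congr EFin; field.
have mDA : measurable (I01 `\` A) by exact: measurableD.
rewrite leeBlDr//; apply: (@le_trans _ _ (mu (I01 `\` A) + mu A)%E); last exact: leeD2l.
rewrite -muI -[in leLHS](_ : (I01 `\` A) `|` A = I01); first exact: (measureU2 mu mDA mA).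
by rewrite setUC setDUK//; exact: subIsetl.
Qed.

Section power_mean.
Variables (b p : R).
Hypotheses (b0 : 0 < b) (p1 : 1 <= p).

Let kb : - kappa < b.
Proof. by rewrite (lt_trans _ b0)// oppr_lt0. Qed.

Let p0 : 0 < p.
Proof. exact: lt_le_trans p1. Qed.

(** This is K_1 / K_0. *)
Definition ratio (e : R) : R := Kmix (b - 1) e / Kmix b e.
(** Up to a factor that depends on e only, the p-th power of u_x along the flow
    times the Jacobian of the flow. *)
Definition dev (e x : R) : R :=
  `|(Jmix e x)^-1 - ratio e| `^ p * Jmix e x `^ b.

Lemma dev_ge0 (e x : R) : 0 <= dev e x.
Proof. by rewrite mulr_ge0// powR_ge0. Qed.

Lemma measurable_dev (e : R) (D : set R) : 0 <= e <= 1 -> measurable_fun D (dev e).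
Proof.
move=> e01; apply: measurable_funM; last exact: measurable_Jmix_powR.
apply: (measurableT_comp (measurable_powR _)).
apply: measurableT_comp => //; apply: measurable_funB => //.
apply: (eq_measurable_fun (fun x => Jmix e x `^ (-1))).
  by move=> x _; rewrite powR_inv1// Jmix_ge0.
exact: measurable_Jmix_powR.
Qed.

Lemma ratio_ge0 (e : R) : 0 <= ratio e.
Proof. by rewrite divr_ge0// Kmix_ge0. Qed.

Lemma ratio_bounded : - kappa < b - 1 -> exists2 M : R, 0 <= M &
  forall e, 0 <= e <= 1 -> ratio e <= M.
Proof.
move=> kb1; have [M HM] := Kmix_bounded kb1; have [c c0 Hc] := Kmix_lower (ltW b0).
exists (M / c) => [|e e01]; last first.
  by rewrite /ratio ler_pM ?Kmix_ge0 ?invr_ge0 ?Kmix_ge0 ?HM// lef_pV2 ?posrE ?Hc// (lt_le_trans c0)// Hc.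
have h : 0 <= (0 : R) <= 1 by rewrite lexx ler01.
by rewrite divr_ge0 ?(ltW c0)// (le_trans (Kmix_ge0 _ _) (HM 0 h)).
Qed.

Lemma ratio_cvg (a : R) : - kappa < b - 1 -> 0 <= a <= 1 ->
  ratio e @[e --> within I01 (nbhs a)] --> ratio a.
Proof.
move=> kb1 a01; have [c c0 Hc] := Kmix_lower (ltW b0).
apply: cvgM; first exact: Kmix_cvg.
apply: cvgV; last exact: Kmix_cvg.
by rewrite gt_eqF// (lt_le_trans c0)// Hc.
Qed.

(** As the ratio K_1/K_0 is at most M and [Jmix] at most B, the difference
    |1/J - K_1/K_0| is at most (1 + M B) / J. This bounds [dev] by a multiple of
    J^(b - p), which is integrable uniformly in e. *)
Lemma dev_cvg : - kappa < b - p ->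
  (\int[mu]_(x in I01) dev e x) @[e --> within I01 (nbhs (1 : R))] -->
  \int[mu]_(x in I01) dev 1 x.
Proof.
move=> kbp; have kb1 : - kappa < b - 1 by rewrite (lt_le_trans kbp)// lerB.
have [M M0 HM] := ratio_bounded kb1.
have h11 : 0 <= (1 : R) <= 1 by rewrite lexx ler01.
apply: (@continuity_integral_within R I01 zeros I01 1 dev
   (fun x => (1 + M * B) `^ p * dom (b - p) x)) => //.
- exact: measurable_zeros.
- exact: measure_zeros.
- by move=> e /=; rewrite in_itv/= => e01; exact: measurable_dev.
- rewrite (_ : _ \o _ = (fun x => ((1 + M * B) `^ p)%:E * (dom (b - p) x)%:E)%E)//.
  by apply: integrableZl => //; exact: integrable_dom.
- move=> x Ix zx e /=; rewrite in_itv/= => e01.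
  have wx := off_zeros Ix zx; have J0 := Jmix_gt0 e01 wx.
  rewrite ger0_norm ?dev_ge0//.
  apply: (@le_trans _ _ ((1 + M * B) `^ p * Jmix e x `^ (b - p))); last first.
    by rewrite ler_wpM2l ?powR_ge0// Jmix_le_dom.
  rewrite /dev (addrC b) powRD ?(gt_eqF J0) ?implybT// mulrA ler_wpM2r ?powR_ge0//.
  have -> : Jmix e x `^ (- p) = (Jmix e x)^-1 `^ p.
    by rewrite -powR_inv1 ?ltW// -powRrM mulN1r.
  have JV : 0 <= (Jmix e x)^-1 by rewrite invr_ge0 ltW.
  have MB : 0 <= 1 + M * B by rewrite addr_ge0// mulr_ge0// (le_trans ler01 B1).
  rewrite [leRHS]mulrC -powRM// ge0_ler_powR ?nnegrE ?(ltW p0) ?mulr_ge0//.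
  have := ratio_ge0 e; have := HM e e01; have := Jmix_leB x e01 => JB rM r0.
  have : ratio e <= (Jmix e x)^-1 * (M * B).
    apply: (le_trans rM); rewrite mulrC -mulrA ler_peMr// ler_pdivlMr ?mul1r//.
  by move=> h; rewrite ler_norml; apply/andP; split; nra.
- move=> x Ix zx; have wx := off_zeros Ix zx; have J0 := Jmix_gt0 h11 wx.
  have cJ := @Jmix_cvg x 1.
  apply: cvgM; last exact: cvg_powR.
  apply: cvg_powR_ge0 => //; apply: cvg_norm; apply: cvgB; last exact: ratio_cvg.
  by apply: cvgV => //; rewrite gt_eqF.
Qed.

Lemma dev_EFin (e : R) : 0 <= e < 1 ->
  (\int[mu]_(x in I01) (dev e x)%:E = (\int[mu]_(x in I01) dev e x)%R%:E)%E.
Proof.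
move=> /andP[e0 e1]; have e01 : 0 <= e <= 1 by rewrite e0 ltW.
have d0 : 0 < 1 - e by rewrite subr_gt0.
rewrite /Rintegral fineK// integrable_fin_num//.
apply: measurable_bounded_integrable => //; first exact: measurable_dev.
exists (((1 - e)^-1 + ratio e) `^ p * B `^ b); split; first exact: num_real.
move=> z /ltW zM x _; apply: le_trans zM; rewrite ger0_norm ?dev_ge0//.
have J0 := lt_le_trans d0 (Jmix_ge x e01); have r0 := ratio_ge0 e.
have JV : (Jmix e x)^-1 <= (1 - e)^-1 by rewrite lef_pV2 ?posrE// Jmix_ge.
have J0V : 0 <= (Jmix e x)^-1 by rewrite invr_ge0 ltW.
apply: ler_pM; rewrite ?powR_ge0//; last first.
  by rewrite ge0_ler_powR ?nnegrE ?(ltW b0) ?(ltW J0) ?Jmix_leB ?(le_trans ler01 B1).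
rewrite ge0_ler_powR ?nnegrE ?(ltW p0) ?addr_ge0 ?invr_ge0 ?(ltW d0)//.
by rewrite ler_norml; apply/andP; split; lra.
Qed.

(** (1 - e) J^(b - 1) is at most J^b, hence bounded, and tends to 0 wherever
    w > 0: dominated convergence applies even when K_1 is unbounded. *)
Lemma eps_ratio_cvg :
  (1 - e) * ratio e @[e --> within I01 (nbhs (1 : R))] --> (0 : R).
Proof.
have h11 : 0 <= (1 : R) <= 1 by rewrite lexx ler01.
have [c c0 Hc] := Kmix_lower (ltW b0).
have K1 : Kmix b 1 != 0 by rewrite gt_eqF// (lt_le_trans c0)// Hc.
suff cK : (1 - e) * Kmix (b - 1) e @[e --> within I01 (nbhs (1 : R))] --> (0 : R).
  have cr : (1 - e) * Kmix (b - 1) e * (Kmix b e)^-1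
      @[e --> within I01 (nbhs (1 : R))] --> 0 * (Kmix b 1)^-1.
    by apply: cvgM => //; apply: cvgV => //; exact: Kmix_cvg.
  rewrite mul0r in cr; apply: cvg_trans cr; apply: near_eq_cvg.
  by apply: nearW => e; rewrite /ratio/= mulrA.
pose f e x := (1 - e) * Jmix e x `^ (b - 1).
have cf : (\int[mu]_(x in I01) f e x) @[e --> within I01 (nbhs (1 : R))] -->
    \int[mu]_(x in I01) f 1 x.
  apply: (@continuity_integral_within R I01 zeros I01 1 f (fun=> B `^ b)) => //.
  - exact: measurable_zeros.
  - exact: measure_zeros.
  - by move=> e _; apply: measurable_funM => //; exact: measurable_Jmix_powR.
  - apply: (@measurable_bounded_integrable _ _ _ mu (fun=> B `^ b)) => //.
    by exists `|B `^ b|; split; [exact: num_real|move=> z /ltW zc y _].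
  - move=> x Ix zx e /=; rewrite in_itv/= => e01.
    have wx := off_zeros Ix zx; have J0 := Jmix_gt0 e01 wx.
    have /andP[_ e1] := e01.
    rewrite ger0_norm ?mulr_ge0 ?powR_ge0 ?subr_ge0//.
    apply: (@le_trans _ _ (Jmix e x * Jmix e x `^ (b - 1))).
      by rewrite ler_wpM2r ?powR_ge0// Jmix_ge.
    rewrite mulr_powRB1 ?(ltW J0)//.
    by rewrite ge0_ler_powR ?nnegrE ?(ltW b0) ?(ltW J0) ?Jmix_leB ?(le_trans ler01 B1).
  - move=> x Ix zx; have wx := off_zeros Ix zx; have J0 := Jmix_gt0 h11 wx.
    have c1 : 1 - e @[e --> within I01 (nbhs (1 : R))] --> (1 - 1 : R).
      by apply: cvg_within_filter; apply: cvgB; [exact: cvg_cst|exact: cvg_id].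
    by apply: cvgM => //; apply: cvg_powR => //; exact: Jmix_cvg.
have f1 : \int[mu]_(x in I01) f 1 x = 0.
  rewrite /Rintegral (eq_integral (fun=> 0%E)) ?integral0// => x _.
  by rewrite /f subrr mul0r.
rewrite f1 in cf; apply: cvg_trans cf; apply: near_eq_cvg.
rewrite near_withinE; apply: nearW => e /=; rewrite in_itv/= => /[dup] e01 /andP[e0 e1].
have [->|en1] := eqVneq e 1; first by rewrite f1 subrr mul0r.
by rewrite /f RintegralZl//; apply: integrable_Jmix_lt; rewrite e0 lt_neqAle en1.
Qed.

(** Where w <= 1 - e one has 1 - e <= J <= 2 (1 - e), so 1/J is at least
    1/2 / (1 - e), whereas K_1/K_0 is at most half of that. *)
Lemma dev_ge_small (e x : R) : 0 <= e < 1 -> (1 - e) * ratio e <= 4^-1 ->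
  w x <= 1 - e -> (4^-1 / (1 - e)) `^ p * (1 - e) `^ b <= dev e x.
Proof.
move=> /andP[e0 e1] er wx; have e01 : 0 <= e <= 1 by rewrite e0 ltW.
have d0 : 0 < 1 - e by rewrite subr_gt0.
have J0 := lt_le_trans d0 (Jmix_ge x e01).
have J2 : Jmix e x <= 2 * (1 - e) by rewrite /Jmix; have := w0 x; nra.
rewrite ler_pM ?powR_ge0//; last first.
  by rewrite ge0_ler_powR ?nnegrE ?(ltW b0) ?(ltW J0) ?Jmix_ge ?(ltW d0).
rewrite ge0_ler_powR ?nnegrE ?(ltW p0) ?divr_ge0 ?(ltW d0)//.
have h1 : 2^-1 / (1 - e) <= (Jmix e x)^-1.
  by rewrite -invfM lef_pV2 ?posrE ?mulr_gt0.
have h2 : ratio e <= 4^-1 / (1 - e) by rewrite ler_pdivlMr// mulrC.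
apply: le_trans (ler_norm _).
have : 4^-1 / (1 - e) + 4^-1 / (1 - e) = 2^-1 / (1 - e) by field; rewrite gt_eqF.
by lra.
Qed.

Lemma measurable_sublevel_le d : measurable (I01 `&` [set x | w x <= d]).
Proof.
apply: measurableI => //.
rewrite -[X in measurable X]setTI (_ : [set x | w x <= d] = w @^-1` `]-oo, d]%classic).
  exact: mw.
by apply/seteqP; split => x /=; rewrite in_itv.
Qed.

(** The lower bound of [dev_ge_small] on the set w <= 1 - e, whose measure is at
    least c (1 - e)^kappa, gives a multiple of (1 - e)^(b - p + kappa). *)
Lemma dev_lower (c d0 : R) : 0 < c -> 0 < d0 -> b - p + kappa < 0 ->
  (forall d, 0 < d < d0 ->
    ((c * d `^ kappa)%:E <= mu (I01 `&` [set x | (w x <= d)%R]))%E) ->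
  forall M : R, \forall e \near (1 : R)^'-, (M%:E <= \int[mu]_(x in I01) (dev e x)%:E)%E.
Proof.
move=> c0 d00 sig Hc M.
pose s := - (b - p + kappa); have s0 : 0 < s by rewrite oppr_gt0.
(* for 1 - e < m the lower bound is at least M *)
pose m := (4^-1 `^ p * c / (`|M| + 1)) `^ s^-1.
have M10 : 0 < `|M| + 1 by rewrite ltr_wpDl.
have m0 : 0 < m by rewrite powR_gt0// divr_gt0// mulr_gt0// powR_gt0// invr_gt0.
have er : \forall e \near (1 : R)^'-, (1 - e) * ratio e <= 4^-1.
  have /cvgrPdist_le := cvg_within_at_left1 eps_ratio_cvg.
  have h4 : 0 < 4 :> R by rewrite ltr0n.
  move=> /(_ 4^-1); rewrite invr_gt0 => /(_ h4).
  by apply: filterS => e; rewrite sub0r normrN => /(le_trans (ler_norm _)).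
near=> e.
have e1 : e < 1 by near: e; exact: nbhs_left_lt.
have e0 : 0 <= e by near: e; apply: nbhs_left_ge.
have ed : 1 - e < d0.
  have : 1 - d0 < e by near: e; apply: nbhs_left_gt; rewrite ltrBlDr ltrDl.
  by lra.
have em : 1 - e < m.
  have : 1 - m < e by near: e; apply: nbhs_left_gt; rewrite ltrBlDr ltrDl.
  by lra.
have hr : (1 - e) * ratio e <= 4^-1 by near: e.
have e01 : 0 <= e <= 1 by rewrite e0 ltW.
set d := 1 - e in ed em hr; have dgt0 : 0 < d by rewrite subr_gt0.
pose A := I01 `&` [set x | (w x <= d)%R].
have mA : measurable A := measurable_sublevel_le d.
apply: (@le_trans _ _ (\int[mu]_(x in A) (dev e x)%:E)%E); last first.
  apply: ge0_subset_integral => //.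
  - by apply/measurable_EFinP; exact: measurable_dev.
  - by move=> x _; rewrite lee_fin dev_ge0.
  - by move=> x [].

apply: (@le_trans _ _ (\int[mu]_(x in A) ((4^-1 / d) `^ p * d `^ b)%:E)%E); last first.
  apply: ge0_le_integral => //.
  - by move=> x _; rewrite lee_fin mulr_ge0 ?powR_ge0.
  - by apply/measurable_EFinP; exact: measurable_dev.
  - by move=> x [_ wx]; rewrite lee_fin dev_ge_small// e0.
rewrite integral_cst//.
have D0 : 0 <= (4^-1 / d) `^ p * d `^ b by rewrite mulr_ge0 ?powR_ge0.
apply: (@le_trans _ _ (((4^-1 / d) `^ p * d `^ b)%:E * (c * d `^ kappa)%:E)%E); last first.
  by rewrite lee_wpmul2l ?lee_fin// Hc// dgt0.
rewrite -EFinM lee_fin.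
have -> : (4^-1 / d) `^ p * d `^ b * (c * d `^ kappa) = 4^-1 `^ p * c / d `^ s.
  rewrite powRM ?invr_ge0 ?(ltW dgt0)//.
  have -> : d^-1 `^ p = d `^ (- p) by rewrite -powR_inv1 ?(ltW dgt0)// -powRrM mulN1r.
  have dn0 := gt_eqF dgt0.
  rewrite -powRN /s opprK (addrC b) !powRD ?dn0 ?implybT//.
  by ring.
rewrite ler_pdivlMr ?powR_gt0//.
have h : d `^ s <= 4^-1 `^ p * c / (`|M| + 1).
  have := @ge0_ler_powR R s (ltW s0) d m; rewrite !nnegrE => /(_ (ltW dgt0) (ltW m0) (ltW em)).
  by rewrite /m -powRrM mulVf ?gt_eqF// powRr1// divr_ge0 ?mulr_ge0 ?powR_ge0 ?(ltW c0) ?(ltW M10).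
move: h; rewrite ler_pdivlMr// => h; apply: le_trans h; rewrite mulrC ler_wpM2l ?powR_ge0//.
by rewrite (le_trans (ler_norm _))// lerDl.
Unshelve. all: by end_near. Qed.

End power_mean.

End profile.

(** * The time change *)

Section blowup_time.
Context (R : realType).
Notation mu := (@lebesgue_measure R).
Variables (k eta : R -> R) (es c : R).
Hypotheses (es0 : 0 < es) (c0 : 0 < c) (k0 : forall h, 0 <= k h).
Hypothesis kc : forall h, 0 <= h <= es -> c <= k h.
Hypothesis kcont : forall a, 0 <= a <= es ->
  k h @[h --> within `[0%R, es]%classic (nbhs a)] --> k a.

Let T : R := lim ((\int[mu]_(s in `[0, h]) k s) @[h --> es^'-]).

Hypothesis eta0 : eta 0 = 0.
Hypothesis etac : {within `[0, T[, continuous eta}.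
Hypothesis eta_d : forall t, 0 < t < T -> is_derive t (1 : R) eta (k (eta t))^-1.
Hypothesis eta_es : forall t, 0 <= t < T -> eta t < es.

(** The integrand is extended continuously to the right of es and to the left of 0
    by its end values, so that its primitive F based at -1 is differentiable at
    every point of [0, es]. *)
Let clamp (y : R) : R := Num.max 0 (Num.min y es).

Let clamp01 y : 0 <= clamp y <= es.
Proof.
by rewrite /clamp le_max lexx/= ge_max (ltW es0)/= ge_min lexx orbT.
Qed.

Let clamp_id y : 0 <= y <= es -> clamp y = y.
Proof. by move=> /andP[y0 y1]; rewrite /clamp min_l// max_r. Qed.

Let clamp_lip x y : `|clamp x - clamp y| <= `|x - y|.
Proof.
have h1 := ler_norm (x - y); have h2 := ler_norm (y - x); rewrite distrC in h2.
rewrite /clamp ler_norml.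
have es_ge := es0; apply/andP; split;
  case: (leP x es) => h3; case: (leP y es) => h4;
  repeat (match goal with |- context [Num.max 0 ?z] => case: (leP 0 z) => ? end); lra.
Qed.

Let kt y := k (clamp y).

Let kt_ge y : c <= kt y.
Proof. by apply: kc; exact: clamp01. Qed.

Let kt_cont : continuous kt.
Proof.
move=> a; apply/cvgrPdist_lt => e e0.
have /cvgrPdist_lt/(_ e e0) := kcont (clamp01 a).
rewrite near_withinE => /nbhs_ballP[d /= d0 Hd].
apply/nbhs_ballP; exists d => // y ay; apply: Hd.
  by rewrite /ball/= (le_lt_trans (clamp_lip _ _)).
by rewrite /= in_itv/=; exact: clamp01.
Qed.

Let kt_int (a b : R) : mu.-integrable `[a, b] (EFin \o kt).
Proof.
apply: continuous_compact_integrable; first exact: segment_compact.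
exact: continuous_subspaceT.
Qed.

Let F (y : R) : R := \int[mu]_(s in `[-1, y]) kt s.

Let dF (y : R) : -1 < y -> is_derive y (1 : R) F (kt y).
Proof.
move=> y1; have yy : y < y + 1 by rewrite ltrDl.
have [] := @continuous_FTC1 R kt (BLeft (-1)) y (y + 1) yy (kt_int _ _).
- by rewrite lte_fin.
- exact: kt_cont.
move=> dF Fy; apply: DeriveDef; first exact: dF.
by rewrite -derive1E; exact: Fy.
Qed.

Let F_cont (y : R) : -1 < y -> {for y, continuous F}.
Proof.
move=> y1; have [dF_ _] := dF y1.
by apply/differentiable_continuous/derivable1_diffP.
Qed.

Let F_lt (y z : R) : -1 < y -> y < z -> F y < F z.
Proof.
move=> y1 yz; have [||x _ xE] := @MVT R F kt y z yz.
- by move=> x; rewrite in_itv/= => /andP[yx _]; apply: dF; exact: lt_trans yx.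
- apply: continuous_in_subspaceT => x; rewrite inE/= in_itv/= => /andP[yx _].
  by apply: F_cont; exact: lt_le_trans yx.
rewrite -subr_gt0 xE mulr_gt0// ?subr_gt0//.
exact: lt_le_trans (kt_ge _).
Qed.

Let Phi_F (h : R) : 0 <= h <= es -> \int[mu]_(s in `[0, h]) k s = F h - F 0.
Proof.
move=> /andP[h0 h1]; rewrite /F (@Rintegral_itvB R kt (BLeft (-1)) (BRight h) 0); last 3 first.
- exact: kt_int.
- by rewrite bnd_simp lerN10.
- by rewrite bnd_simp.
rewrite Rintegral_itv_obnd_cbnd; last first.
  by apply: integrableS (kt_int 0 h) => //; apply: subset_itvr; rewrite bnd_simp.
apply: eq_Rintegral => x; rewrite inE/= in_itv/= => /andP[x0 xh].
by rewrite /kt clamp_id// x0 (le_trans xh).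
Qed.

Lemma blowup_timeE : T = F es - F 0.
Proof.
apply: cvg_lim => //.
have Fes : F h - F 0 @[h --> es^'-] --> F es - F 0.
  apply: cvgB; last exact: cvg_cst.
  have h1 : -1 < es by rewrite (lt_trans _ es0)// ltrN10.
  by apply: cvg_within_filter; exact: F_cont.
apply: cvg_trans Fes; apply: near_eq_cvg; near=> h.
rewrite Phi_F//; apply/andP; split.
  by near: h; exact: nbhs_left_ge.
by near: h; exact: nbhs_left_le.
Unshelve. all: by end_near. Qed.

Lemma blowup_time_gt0 : 0 < T.
Proof. by rewrite blowup_timeE subr_gt0 F_lt// ltrN10. Qed.

Let eta_cont (t : R) : t < T -> {within `[0, t], continuous eta}.
Proof.
move=> tT; apply: continuous_subspaceW etac => x /=; rewrite !in_itv/=.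
by move=> /andP[-> /le_lt_trans]; exact.
Qed.

(** The derivative of eta is nonnegative whatever the value of eta, since k is. *)
Lemma eta_ge0 (t : R) : 0 <= t < T -> 0 <= eta t.
Proof.
move=> /andP[]; rewrite le_eqVlt => /predU1P[<-|t0] tT; first by rewrite eta0.
have [|x _ xE] := @MVT R eta (fun s => (k (eta s))^-1) 0 t t0 _ (eta_cont tT).
  by move=> x; rewrite in_itv/= => /andP[x0 xt]; apply: eta_d; rewrite x0 (lt_trans xt).
by rewrite eta0 !subr0 in xE; rewrite xE mulr_ge0 ?invr_ge0 ?k0 ?(ltW t0).
Qed.

Let F_eta (t : R) : 0 <= t < T -> F (eta t) - F 0 = t.
Proof.
move=> /[dup] tT0 /andP[]; rewrite le_eqVlt => /predU1P[<-|t0] tT.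
  by rewrite eta0 subrr.
have [||x _] := @MVT R (F \o eta) (fun=> 1) 0 t t0.
- move=> x; rewrite in_itv/= => /andP[x0 xt].
  have xT : 0 <= x < T by rewrite ltW// (lt_trans xt).
  have e0 := eta_ge0 xT; have e1 := eta_es xT.
  have eN1 : -1 < eta x by rewrite (lt_le_trans _ e0)// ltrN10.
  have h1 := dF eN1; have h2 : is_derive x (1 : R) eta (k (eta x))^-1.
    by apply: eta_d; rewrite x0 (lt_trans xt).
  have := @is_derive1_comp R F eta x _ _ h1 h2.
  rewrite /kt clamp_id ?e0 ?ltW// mulfV// gt_eqF// (lt_le_trans c0)// kc//.
  by rewrite e0 ltW.
- have eN1 x : 0 <= x <= t -> -1 < eta x.
    move=> /andP[x0 xt]; rewrite (lt_le_trans (ltrN10 R))// eta_ge0// x0.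
    exact: le_lt_trans tT.
  have /(continuous_within_itvP eta t0)[ec e0 et] := eta_cont tT.
  apply/(continuous_within_itvP _ t0); split.
  + move=> x /[dup] xt /=; rewrite in_itv/= => /andP[x0 x1].
    apply: (@continuous_comp _ _ _ eta F); first exact: ec.
    by apply: F_cont; rewrite eN1// !ltW.
  + by apply: (cvg_comp _ _ e0); apply: F_cont; rewrite eN1// lexx ltW.
  + by apply: (cvg_comp _ _ et); apply: F_cont; rewrite eN1// lexx ltW.
by rewrite /= eta0 mul1r subr0.
Qed.

(** The derivative of F (eta t) is 1, so F (eta t) - F 0 = t, and T = F es - F 0.
    As F is strictly increasing, t close to T forces eta t close to es. *)
Lemma eta_cvg : eta t @[t --> T^'-] --> es.
Proof.
apply/cvgrPdist_lt => e e0.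
pose y0 := Num.max 0 (es - e / 2).
have y0ge : 0 <= y0 by rewrite le_max lexx.
have y0es : y0 < es by rewrite gt_max es0/= ltrBlDr ltrDl divr_gt0.
have y0N : -1 < y0 by rewrite (lt_le_trans _ y0ge)// ltrN10.
near=> t.
have t0 : 0 <= t by near: t; apply: nbhs_left_ge; exact: blowup_time_gt0.
have tT : t < T by near: t; exact: nbhs_left_lt.
have tI : 0 <= t < T by rewrite t0.
have ty : F y0 - F 0 < t.
  by near: t; apply: nbhs_left_gt; rewrite blowup_timeE ltrD2r F_lt.
have : y0 < eta t.
  rewrite ltNge; apply/negP; rewrite le_eqVlt => /predU1P[ey|ey].
    by move: ty; rewrite -[X in _ < X](F_eta tI) ey ltxx.
  move: ty; rewrite -[X in _ < X](F_eta tI) ltrD2r ltNge ltW// F_lt//.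
  by rewrite (lt_le_trans _ (eta_ge0 tI))// ltrN10.
rewrite gt_max => /andP[_ h]; have := eta_es tI => h1.
by rewrite ger0_norm ?subr_ge0 ?ltW//; lra.
Unshelve. all: by end_near. Qed.

End blowup_time.

(** * The rescaled slope at blow-up *)

Section profile_of_data.
Context (R : realType).
Notation mu := (@lebesgue_measure R).
Variables (lam q C2 m0 : R) (u0 du0 : R -> R).
Hypotheses (hlam : lam < 0) (hq : 0 < q) (hC2 : 0 < C2).
Hypotheses (hdata : initial_data u0 du0) (hmin : negative_minimum du0 m0).
Hypothesis horder : forall a, du0 a = m0 -> min_order du0 m0 C2 q a.

Lemma eta_star_gt0 : 0 < eta_star lam m0.
Proof. by rewrite invr_gt0 nmulr_lgt0// (min_lt0 hmin). Qed.

Lemma minimum_in_period : exists2 a, 0 <= a < 1 & du0 a = m0.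
Proof.
have [x xm] := min_attained hmin.
exists (x - (Num.floor x)%:~R).
  by rewrite subr_ge0 ge_floor/= ltrBlDl -intrD1 floorD1_gt.
by rewrite -mulrNz periodic1_int//; exact: (data_dper hdata).
Qed.

(** The function w is the rescaled Borel version of u_0'. The lower bound on
    the measure of the set w <= d comes from an interval to the right of one
    minimum point in [0, 1[, short enough to stay inside the period and inside the
    range of [min_order_bounds]. *)
Lemma profile_exists : exists (N : set R) (w : R -> R) (B C c d0 : R),
  [/\ measurable N, mu N = 0%E, profile w B C q^-1 & periodic1 w] /\
  [/\ 0 < c, 0 < d0 & forall d, 0 < d < d0 ->
    ((c * d `^ q^-1)%:E <= mu (`[0%R, 1%R]%classic `&` [set x | (w x <= d)%R]))%E] /\
  (forall h x, ~ N x -> Jfac lam du0 h x = Jmix w (h / eta_star lam m0) x).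
Proof.
have m00 := min_lt0 hmin; have m0n : m0 != 0 by rewrite lt_eqF.
have m0p : 0 < - m0 by rewrite oppr_gt0.
have [N [mN N0 mg pg]] := borel_version (data_dper hdata) (data_cont hdata).
set g := du0 \_ (~` N) in mg pg.
have gE x : ~ N x -> g x = du0 x by move=> Nx; rewrite /g patchE mem_set.
have gN x : N x -> g x = 0.
  by move=> Nx; rewrite /g patchE memNset//= => /(_ Nx).
have g_ge x : m0 <= g x.
  by have [Nx|Nx] := pselect (N x); [rewrite gN// ltW|rewrite gE// (min_le hmin)].
pose w x := (g x - m0) / (- m0).
have w0 x : 0 <= w x by rewrite divr_ge0 ?(ltW m0p)// subr_ge0.
have mw : measurable_fun setT w.
  by apply: measurable_funM => //; exact: measurable_funB.
have [M HM] := data_bounded hdata.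
have M0 : 0 <= M by rewrite (le_trans _ (HM 0)).
have g_le x : g x <= M.
  have [Nx|Nx] := pselect (N x); first by rewrite gN.
  by rewrite gE// (le_trans (ler_norm _)).
pose B := (M - m0) / (- m0).
have [C C0 HC] := sublevel_measure hq hC2 (data_dper hdata) hmin horder mg.
have [a /andP[a0 a1] am] := minimum_in_period.
have [e e0 He] := min_order_bounds hC2 horder am.
pose m := Num.min e (1 - a).
have mp : 0 < m by rewrite lt_min e0 subr_gt0.
have C22 : 0 < 2 * C2 by rewrite mulr_gt0.
pose c := (- m0 / (2 * C2)) `^ q^-1.
pose d0 := 2 * C2 / (- m0) * m `^ q.
exists N, w, B, (C * (- m0) `^ q^-1), c, d0; split; [|split].
- split => //; last by move=> x; rewrite /w pg.
  split => //.
  + by move=> x; rewrite /w /B ler_pM2r ?invr_gt0// lerD2r.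
  + by rewrite /B ler_pdivlMr// mul1r lerDr.
  + by rewrite mulr_ge0// powR_ge0.
  + by rewrite invr_gt0.
  move=> d dp; have := HC (- m0 * d) (mulr_gt0 m0p dp).
  rewrite powRM ?(ltW m0p) ?(ltW dp)// mulrA.
  congr (_ <= _)%E; congr (mu (_ `&` _)); apply/seteqP.
  by split => x /=; rewrite /w ltr_pdivrMr// mulrC.
- split.
  + by rewrite powR_gt0// divr_gt0.
  + by rewrite mulr_gt0 ?powR_gt0// divr_gt0.
  move=> d /andP[dp dd0].
  set A := _ `&` _.
  have mA : measurable A.
    apply: measurableI => //.
    rewrite -[X in measurable X]setTI (_ : [set x | _] = w @^-1` `]-oo, d]%classic).
      exact: mw.
    by apply/seteqP; split => x /=; rewrite in_itv.
  pose rho := (- m0 / (2 * C2) * d) `^ q^-1.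
  have t0 : 0 < - m0 / (2 * C2) * d by rewrite mulr_gt0// divr_gt0.
  have rho0 : 0 < rho by rewrite powR_gt0.
  have rhoq : rho `^ q = - m0 / (2 * C2) * d.
    by rewrite /rho -powRrM mulVf ?gt_eqF// powRr1// ltW.
  have rhom : rho < m.
    have h : - m0 / (2 * C2) * d < m `^ q.
      have <- : - m0 / (2 * C2) * d0 = m `^ q by rewrite /d0; field; rewrite m0n gt_eqF.
      by rewrite ltr_pM2l// divr_gt0.
    rewrite ltNge; apply/negP => hm; have := @ge0_ler_powR R q (ltW hq) m rho.
    rewrite !nnegrE => /(_ (ltW mp) (ltW rho0) hm); rewrite rhoq; lra.
  have -> : c * d `^ q^-1 = rho.
    by rewrite /rho powRM ?(ltW dp)// divr_ge0 ?(ltW m0p)// ltW.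
  have rhoE : mu `]a, (a + rho)%R[%classic = rho%:E.
    by rewrite lebesgue_measure_itv/= lte_fin ltrDl rho0 -EFinB addrC addKr.
  rewrite -rhoE.
  have sub : `]a, (a + rho)%R[%classic `<=` A `|` N.
    move=> x; rewrite /= in_itv/= => /andP[ax xr].
    have [Nx|Nx] := pselect (N x); [by right|left].
    have xa : `|x - a| = x - a by rewrite gtr0_norm// subr_gt0.
    move: (rhom); rewrite /m lt_min => /andP[rhoe rho1].
    split; first by rewrite /= in_itv/=; apply/andP; split; lra.
    have xa_e : `|x - a| < e by rewrite xa; lra.
    have xna : x != a by rewrite gt_eqF.
    have /andP[_] := He x xna xa_e.
    rewrite /= /w gE// ler_pdivrMr// => /le_trans; apply.
    have : `|x - a| `^ q <= rho `^ q.
      by rewrite ge0_ler_powR ?nnegrE ?(ltW hq) ?(ltW rho0)// xa; lra.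
    rewrite rhoq -(ler_pM2l C22) => /le_trans; apply.
    rewrite le_eqVlt; apply/orP; left; apply/eqP; field.
    by rewrite gt_eqF.
  apply: (@le_trans _ _ (mu (A `|` N))).
    by apply: le_measure; rewrite ?inE//; exact: measurableU.
  have := measureU2 mu mA mN; rewrite /= N0 adde0; exact.
- move=> h x Nx; rewrite /Jfac /Jmix /w gE// /eta_star.
  by field; rewrite m0n lt_eqF.
Qed.

End profile_of_data.

Lemma Kint_Kmix (R : realType) (lam m0 : R) (du0 w : R -> R) (N : set R) :
  measurable N -> lebesgue_measure N = 0%E ->
  (forall h x, ~ N x -> Jfac lam du0 h x = Jmix w (h / eta_star lam m0) x) ->
  forall i h, Kint lam du0 i h = Kmix w (- i%:R - lam^-1) (h / eta_star lam m0).
Proof.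
move=> mN N0 JE i h; rewrite /Kint /Kmix.
apply: (@eq_Rintegral_off_null _ (measurableTypeR R) R (@lebesgue_measure R) N) => //.
by move=> x _ Nx; rewrite JE.
Qed.

(** * The norm in Lagrangian coordinates *)

Section lagrangian.
Context (R : realType).
Notation mu := (@lebesgue_measure R).
Variables (gam phi G Q : R -> R) (N : set R) (c M : R).
Hypotheses (mphi : measurable_fun setT phi) (c0 : 0 < c).
Hypotheses (phic : forall x, c <= phi x) (phiM : forall x, phi x <= M).
Hypotheses (phip : periodic1 phi) (phi1 : \int[mu]_(x in `[0%R, 1%R]) phi x = 1).
Hypothesis gamE : forall a b : R, a <= b ->
  gam b - gam a = \int[mu]_(x in `[a, b]) phi x.
Hypotheses (mN : measurable N) (N0 : mu N = 0%E).
Hypotheses (mQ : measurable_fun setT Q) (Q0 : forall x, 0 <= Q x) (Qp : periodic1 Q).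
Hypothesis GQ : forall x, ~ N x -> G (gam x) = Q x.

Let phi0 x : 0 <= phi x.
Proof. exact: le_trans (ltW c0) (phic x). Qed.

Let phi_int (a b : R) : mu.-integrable `[a, b] (EFin \o phi).
Proof.
apply: measurable_bounded_integrable => //.
- by rewrite /= lebesgue_measure_itv/=; case: ifPn => _; rewrite ?ltry.
- exact: measurable_funTS.
exists M; split; first exact: num_real.
by move=> z /ltW Mz x _; rewrite /= ger0_norm// (le_trans (phiM x)).
Qed.

Let gam_int (a b : R) : a <= b ->
  (\int[mu]_(x in `[a, b]) (phi x)%:E = (gam b - gam a)%:E)%E.
Proof.
by move=> ab; rewrite gamE// /Rintegral fineK// integrable_fin_num.
Qed.

Let mu_itv (a b : R) : a <= b -> mu `[a, b]%classic = (b - a)%:E.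
Proof.
rewrite le_eqVlt => /predU1P[->|ab].
  by rewrite set_itv1 lebesgue_measure_set1 subrr.
by rewrite lebesgue_measure_itv/= lte_fin ab.
Qed.

Let gam_ge (a b : R) : a <= b -> c * (b - a) <= gam b - gam a.
Proof.
move=> ab; rewrite -lee_fin -gam_int// EFinM -mu_itv// -integral_cst//.
apply: ge0_le_integral => //.
- by move=> x _; rewrite lee_fin ltW.
- by apply/measurable_EFinP; exact: measurable_funTS.
- by move=> x _; rewrite lee_fin.
Qed.

Let gam_leM (a b : R) : a <= b -> gam b - gam a <= M * (b - a).
Proof.
move=> ab; rewrite -lee_fin -gam_int// EFinM -mu_itv// -integral_cst//.
apply: ge0_le_integral => //.
- by move=> x _; rewrite lee_fin.
- by apply/measurable_EFinP; exact: measurable_funTS.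
- by move=> x _; rewrite lee_fin.
Qed.

Let gam_lt (a b : R) : a < b -> gam a < gam b.
Proof.
move=> ab; rewrite -subr_gt0; apply: lt_le_trans (gam_ge (ltW ab)).
by rewrite mulr_gt0// subr_gt0.
Qed.

Let gam_le (a b : R) : (gam a <= gam b) = (a <= b).
Proof.
apply/idP/idP => [|]; last first.
  by rewrite le_eqVlt => /predU1P[->//|/gam_lt/ltW].
by apply: contraTT; rewrite -!ltNge => /gam_lt.
Qed.

Let gam_cont : continuous gam.
Proof.
have M0 : 0 < M := lt_le_trans c0 (le_trans (phic 0) (phiM 0)).
move=> a; apply/cvgrPdist_le => e e0.
apply/nbhs_ballP; exists (e / M); first by rewrite /= divr_gt0.
move=> y /= ay; apply: (@le_trans _ _ (M * `|a - y|)); last first.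
  by rewrite mulrC -ler_pdivlMr// ltW.
have [ya|ya] := leP a y.
  rewrite (distrC (gam a)) (distrC a) !ger0_norm ?subr_ge0 ?gam_le//.
  exact: gam_leM.
rewrite !ger0_norm ?subr_ge0 ?gam_le ?(ltW ya)//.
by apply: gam_leM; exact: ltW.
Qed.

Let gam_surj (y : R) : exists x, gam x = y.
Proof.
(* gam grows at least at speed c: y is reached within distance r of 0 *)
pose r := (`|y - gam 0|) / c; have r0 : 0 <= r by rewrite divr_ge0// ltW.
have cr : c * r = `|y - gam 0| by rewrite /r mulrC divfK// gt_eqF.
have h1 : y <= gam r.
  have := gam_ge r0; rewrite subr0 cr; have := ler_norm (y - gam 0); lra.
have h2 : gam (- r) <= y.
  have := @gam_ge (- r) 0; rewrite oppr_le0 sub0r opprK => /(_ r0); rewrite cr.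
  by have := ler_norm (gam 0 - y); rewrite distrC; lra.
have rr : - r <= r by rewrite (@le_trans _ _ 0)// oppr_le0.
have [||x _ <-] := @IVT R gam (- r) r y rr.
- exact: continuous_subspaceT.
- by rewrite ge_min le_max h1 h2/= orbT.
by exists x.
Qed.

Let gamV (y : R) : R := sval (cid (gam_surj y)).

Let gamVK : cancel gamV gam.
Proof. by move=> y; rewrite /gamV; case: cid. Qed.

Let gamK : cancel gam gamV.
Proof.
move=> x; apply/eqP; rewrite eq_le -[X in X && _]gam_le -[X in _ && X]gam_le.
by rewrite gamVK lexx.
Qed.

(** Bounds 0 < c <= phi <= M make gam a bi-Lipschitz bijection of the line. The
    function G is known along the flow off the null set N only, so it agrees with
    the Borel function Q o gam^-1 off the image of N, which is null. The
    preimage of [0, 1] under gam is an interval of length 1 which need not be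
    [0, 1], whence the periodicity of Q and phi. *)
Lemma lagrangian_integral :
  (\int[mu]_(y in `]0%R, 1%R[) (G y)%:E =
   \int[mu]_(x in `[0%R, 1%R]) (Q x * phi x)%:E)%E.
Proof.
have [mN' N'0] := measure_image_null mphi phi0 gam_le gamVK gam_int mN N0.
have mV : measurable_fun setT gamV.
  apply: nondecreasing_measurable => // x y xy.
  by rewrite -gam_le !gamVK.
have mQV : measurable_fun setT (Q \o gamV) by exact: measurableT_comp.
have hD : gam @^-1` `[0%R, 1%R]%classic = `[gamV 0, (gamV 0 + 1)%R]%classic.
  have -> : gamV 0 + 1 = gamV 1.
    rewrite -[LHS]gamK; congr gamV.
    have := @gam_int (gamV 0) (gamV 0 + 1); rewrite lerDl ler01 => /(_ isT).
    rewrite (ge0_integral_periodic _ mphi phi0 phip) gamVK subr0.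
    by rewrite -[LHS]fineK ?integrable_fin_num// => -[<-].
  apply/seteqP; split => x /=; rewrite !in_itv/=.
    by rewrite -(gam_le (gamV 0)) -(gam_le x) !gamVK.
  by rewrite -(gam_le (gamV 0)) -(gam_le x) !gamVK.
rewrite (@eq_integral_off_null _ (measurableTypeR R) R mu (gamV @^-1` N) mN' N'0 _ _
  (fun y => (Q (gamV y))%:E)); last first.
  by move=> y _ Ny; rewrite -GQ// gamVK.
rewrite -(@integral_itv_bndoo R 0 1 (fun y => (Q (gamV y))%:E) true false); last first.
  by apply/measurable_EFinP; exact: measurable_funTS.
rewrite (ge0_change_of_variables mphi phi0 gam_le gamVK gam_int); last 3 first.
- exact: measurable_itv.
- by apply/measurable_EFinP; exact: measurable_funTS.
- by move=> x _; rewrite lee_fin.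
rewrite [X in integral _ X _]hD.
under eq_integral do rewrite gamK -EFinM.
apply: (@ge0_integral_periodic R (fun x => Q x * phi x)).
- exact: measurable_funM.
- by move=> x; rewrite mulr_ge0.
- by move=> x; rewrite Qp phip.
Qed.

End lagrangian.

Lemma Lp_norm01E (R : realType) (p : R) (f : R -> R) : 0 < p ->
  Lp_norm01 p f =
  ((\int[@lebesgue_measure R]_(y in `]0%R, 1%R[) (`|f y| `^ p)%:E) `^ p^-1)%E.
Proof.
move=> p0; rewrite /Lp_norm01 unlock; congr (_ `^ _)%E.
rewrite [RHS]integral_mkcond; apply: eq_integral => x _.
rewrite !patchE; case: ifPn => _ //=.
by rewrite normr0 powR0// gt_eqF.
Qed.

Lemma cvg_within_of (R : realType) (T : Type) (F : set_system T) {FF : Filter F}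
    (f : T -> R) (D : set R) (a : R) :
  f x @[x --> F] --> a -> (\forall x \near F, D (f x)) ->
  f x @[x --> F] --> within D (nbhs a).
Proof.
move=> fa fD A DA; have fA : \forall x \near F, D (f x) -> A (f x) by exact: (fa _ DA).
by apply: filterS2 fD fA => x Dx; apply.
Qed.

Section norm_along_flow.
Context (R : realType).
Notation mu := (@lebesgue_measure R).
Variables (lam m0 : R) (du0 eta : R -> R) (ux gam : R -> R -> R) (T : R).
Variables (N : set R) (w : R -> R) (B C kappa : R).
Local Notation es := (eta_star lam m0).
Variable b : R.
Hypothesis bE : b = - lam^-1.
Hypotheses (hlam : lam < 0) (es0 : 0 < es).
Hypotheses (mN : measurable N) (N0 : mu N = 0%E).
Hypotheses (hw : profile w B C kappa) (wp : periodic1 w).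
Hypothesis JE : forall h x, ~ N x -> Jfac lam du0 h x = Jmix w (h / es) x.
Hypothesis hrep : representation lam du0 T eta ux gam.

Let b0 : 0 < b.
Proof. by rewrite bE oppr_gt0 invr_lt0. Qed.

Let kb : - kappa < b.
Proof. by rewrite (lt_trans _ b0)// oppr_lt0 (prof_kappa hw). Qed.

Lemma Kint0E h : Kint lam du0 0 h = Kmix w b (h / es).
Proof. by rewrite (Kint_Kmix mN N0 JE) oppr0 add0r bE. Qed.

Lemma Kint1E h : Kint lam du0 1 h = Kmix w (b - 1) (h / es).
Proof. by rewrite (Kint_Kmix mN N0 JE) addrC bE. Qed.

(** The factor that depends on e only in the p-th power of the norm. *)
Definition amplitude (p e : R) : R :=
  `|(lam * (e * es) * Kmix w b e `^ (2 * lam))^-1| `^ p / Kmix w b e.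

Lemma amplitude_ge0 (p e : R) : 0 <= amplitude p e.
Proof. by rewrite divr_ge0 ?powR_ge0 ?Kmix_ge0. Qed.

(** K_0 stays away from 0 and infinity as e tends to 1. *)
Lemma amplitude_cvg (p : R) : 0 < p -> exists2 l : R, 0 < l &
  amplitude p (e : R) @[e --> within `[0%R, 1%R]%classic (nbhs (1 : R))] --> l.
Proof.
move=> p0; have h11 : 0 <= (1 : R) <= 1 by rewrite lexx ler01.
have [c c0 Hc] := Kmix_lower hw (ltW b0).
have K1 : 0 < Kmix w b 1 by rewrite (lt_le_trans c0)// Hc.
have Kc := Kmix_cvg hw kb h11.
have d0 : lam * (1 * es) * Kmix w b 1 `^ (2 * lam) != 0.
  by rewrite !mulf_eq0 !negb_or (lt_eqF hlam) oner_eq0 (gt_eqF es0) gt_eqF ?powR_gt0.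
exists (amplitude p 1).
  by rewrite divr_gt0// powR_gt0// normr_gt0 invr_eq0.
apply: cvgM; last by apply: cvgV => //; rewrite gt_eqF.
apply: cvg_powR; first by rewrite normr_gt0 invr_eq0.
apply: cvg_norm; apply: cvgV => //; apply: cvgM; last exact: cvg_powR.
apply: cvg_within_filter; apply: cvgMr; apply: cvgMl; exact: cvg_id.
Qed.

(** The p-th power of the norm is computed by the change of variables given by the
    flow, whose Jacobian is J^b / K_0. *)
Lemma norm_along_flow (p t : R) : 1 <= p -> 0 < t < T -> 0 <= eta t < es ->
  Lp_norm01 p (ux^~ t) = (((amplitude p (eta t / es))%:E *
    \int[mu]_(x in `[0%R, 1%R]) (dev w b p (eta t / es) x)%:E) `^ p^-1)%E.
Proof.
move=> p1 tT /andP[h0 h1]; have p0 : 0 < p by rewrite (lt_le_trans ltr01).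
rewrite Lp_norm01E//; congr (_ `^ _)%E.
have [e eE] : exists e, e = eta t / es by exists (eta t / es).
have e0 : 0 <= e by rewrite eE divr_ge0// ltW.
have e1 : e < 1 by rewrite eE ltr_pdivrMr// mul1r.
have he : eta t = e * es by rewrite eE divfK// gt_eqF.
rewrite -eE; have e01 : 0 <= e <= 1 by rewrite e0 ltW.
have [c c0 Hc] := Kmix_lower hw (ltW b0).
have K0 : 0 < Kmix w b e by rewrite (lt_le_trans c0)// Hc.
pose A := (lam * (e * es) * Kmix w b e `^ (2 * lam))^-1.
pose phi x := Jmix w e x `^ b / Kmix w b e.
pose Q x := `|A * ((Jmix w e x)^-1 - ratio w b e)| `^ p.
have mJ r : measurable_fun setT (fun x => Jmix w e x `^ r).
  exact: (measurable_Jmix_powR hw).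
have d0 : 0 < 1 - e by rewrite subr_gt0.
have J0 x : 0 < Jmix w e x by exact: lt_le_trans d0 (Jmix_ge hw x e01).
have pJ : periodic1 (Jmix w e) by move=> x; rewrite /Jmix wp.
have mQ : measurable_fun setT Q.
  apply: (measurableT_comp (measurable_powR _)); apply: measurableT_comp => //.
  apply: measurable_funM => //; apply: measurable_funB => //.
  apply: (eq_measurable_fun (fun x => Jmix w e x `^ (-1))) => //.
  by move=> x _; rewrite powR_inv1// ltW.
have t0T : 0 <= t < T by case/andP: tT => t0 ->; rewrite ltW.
have mphi : measurable_fun setT phi by apply: measurable_funM.
have phic x : (1 - e) `^ b / Kmix w b e <= phi x.
  rewrite ler_pM2r ?invr_gt0//.
  by rewrite ge0_ler_powR ?nnegrE ?(ltW b0) ?(ltW (J0 x)) ?(ltW d0) ?(Jmix_ge hw).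
have c1 : 0 < (1 - e) `^ b / Kmix w b e by rewrite divr_gt0// powR_gt0.
have phiM x : phi x <= B `^ b / Kmix w b e.
  rewrite ler_pM2r ?invr_gt0//.
  rewrite ge0_ler_powR ?nnegrE ?(ltW b0) ?(ltW (J0 x)) ?(Jmix_leB hw)//.
  by rewrite (le_trans ler01)// (prof_ge1 hw).
have phip : periodic1 phi by move=> x; rewrite /phi pJ.
have phi1 : \int[mu]_(x in `[0%R, 1%R]) phi x = 1.
  rewrite /phi RintegralZr; last 2 first.
  - exact: measurable_itv.
  - by apply: (integrable_Jmix_lt hw); rewrite e0.
  by rewrite -/(Kmix w b e) mulfV ?gt_eqF.
have K0E : Kint lam du0 0 (eta t) = Kmix w b e by rewrite Kint0E -eE.
have K1E : Kint lam du0 1 (eta t) = Kmix w (b - 1) e by rewrite Kint1E -eE.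
have gamE a b' : a <= b' -> gam b' t - gam a t = \int[mu]_(x in `[a, b']) phi x.
  move=> ab; rewrite (rep_gam hrep t0T ab) K0E.
  apply: (@eq_Rintegral_off_null _ (measurableTypeR R) R mu N _ _ _ mN N0).
  by move=> x _ Nx; rewrite (JE _ Nx) -eE -bE.
have Q0 x : 0 <= Q x by rewrite powR_ge0.
have Qp : periodic1 Q by move=> x; rewrite /Q pJ.
have GQ x : ~ N x -> `|ux (gam x t) t| `^ p = Q x.
  by move=> Nx; rewrite /Q (rep_ux hrep x tT) K0E K1E (JE _ Nx) -eE {1}he.
rewrite (@lagrangian_integral R (gam^~ t) phi (fun y => `|ux y t| `^ p) Q N _ _
  mphi c1 phic phiM phip phi1 gamE mN N0 mQ Q0 Qp GQ).
clear phi1 K0E K1E.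
rewrite -ge0_integralZl_EFin//; last 3 first.
- by move=> x _; rewrite lee_fin dev_ge0.
- by apply/measurable_EFinP; exact: (measurable_dev hw).
- exact: amplitude_ge0.
apply: eq_integral => x _; rewrite -EFinM; congr EFin.
rewrite /Q /phi /amplitude /dev -/A normrM powRM//.
by ring.
Qed.

End norm_along_flow.

(** * The norm near the blow-up time *)

Section limits.
Context (R : realType).
Notation mu := (@lebesgue_measure R).
Variables (lam q C2 m0 : R) (u0 du0 eta : R -> R) (ux gam : R -> R -> R).
Hypotheses (hlam : lam < 0) (hq : 0 < q) (hC2 : 0 < C2).
Hypotheses (hdata : initial_data u0 du0) (hmin : negative_minimum du0 m0).
Hypothesis horder : forall a, du0 a = m0 -> min_order du0 m0 C2 q a.
Hypothesis heta : eta_solution lam du0 m0 eta.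
Hypothesis hrep : representation lam du0 (t_star lam du0 m0) eta ux gam.
Local Notation es := (eta_star lam m0).
Local Notation T := (t_star lam du0 m0).
Variable b : R.
Hypothesis bE : b = - lam^-1.

Let es0 : 0 < es := eta_star_gt0 hlam hmin.

Let b0 : 0 < b.
Proof. by rewrite bE oppr_gt0 invr_lt0. Qed.

Section with_profile.
Variables (N : set R) (w : R -> R) (B C : R).
Hypotheses (mN : measurable N) (N0 : mu N = 0%E).
Hypotheses (hw : profile w B C q^-1) (wp : periodic1 w).
Hypothesis JE : forall h x, ~ N x -> Jfac lam du0 h x = Jmix w (h / es) x.

Let kb : - q^-1 < b.
Proof. by rewrite (lt_trans _ b0)// oppr_lt0 invr_gt0. Qed.

Let k (h : R) := Kint lam du0 0 h `^ (2 * lam).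

Let kE h : k h = Kmix w b (h / es) `^ (2 * lam).
Proof. by rewrite /k (Kint0E bE mN N0 JE). Qed.

Let unit_of h : 0 <= h <= es -> 0 <= h / es <= 1.
Proof.
by move=> /andP[h0 h1]; rewrite divr_ge0 ?(ltW es0)//= ler_pdivrMr// mul1r.
Qed.

Let k_lower : exists2 c, 0 < c & forall h, 0 <= h <= es -> c <= k h.
Proof.
have [M HM] := Kmix_bounded hw kb; have [c c0 Hc] := Kmix_lower hw (ltW b0).
have h11 : 0 <= (1 : R) <= 1 by rewrite lexx ler01.
have M0 : 0 < M by rewrite (lt_le_trans c0)// (le_trans (Hc 1 h11))// HM.
exists (M `^ (2 * lam)); first by rewrite powR_gt0.
move=> h /unit_of h01; rewrite kE; apply: ler_powR_npos.
- by rewrite (lt_le_trans c0)// Hc.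
- exact: HM.
- by rewrite mulr_ge0_le0// ltW.
Qed.

Let k_cont a : 0 <= a <= es ->
  k h @[h --> within `[0%R, es]%classic (nbhs a)] --> k a.
Proof.
move=> ha; have a01 := unit_of ha; have [c c0 Hc] := Kmix_lower hw (ltW b0).
rewrite (_ : k = fun h => Kmix w b (h / es) `^ (2 * lam)); last exact/funext.
apply: cvg_powR; first by rewrite (lt_le_trans c0)// Hc.
have hc : h / es @[h --> within `[0%R, es]%classic (nbhs a)] -->
    within `[0%R, 1%R]%classic (nbhs (a / es)).
  apply: cvg_within_of; first by apply: cvg_within_filter; apply: cvgMl; exact: cvg_id.
  rewrite near_withinE; apply: nearW => h; rewrite /= !in_itv/=.
  exact: unit_of.
exact: (cvg_comp _ _ hc (Kmix_cvg hw kb a01)).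
Qed.

Let eta_d t : 0 < t < T -> is_derive t (1 : R) eta (k (eta t))^-1.
Proof. by move=> tT; rewrite /k -powRN; exact: (eta_ode heta). Qed.

Let k0 h : 0 <= k h.
Proof. exact: powR_ge0. Qed.

Lemma t_star_gt0 : 0 < T.
Proof. by have [c c0 kc] := k_lower; exact: (blowup_time_gt0 es0 c0 kc k_cont). Qed.

Let fraction t := eta t / es.

Let eta_range t : 0 <= t < T -> 0 <= eta t < es.
Proof.
move=> tT; rewrite (eta_lt heta)// andbT; have [c c0 kc] := k_lower.
exact: (eta_ge0 k0 (eta_init heta) (eta_cont heta) eta_d).
Qed.

Let fraction01 : \forall t \near T^'-, 0 < t < T /\ 0 <= fraction t < 1.
Proof.
near=> t.
have t0 : 0 < t by near: t; apply: nbhs_left_gt; exact: t_star_gt0.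
have tT : t < T by near: t; exact: nbhs_left_lt.
have tI : 0 <= t < T by rewrite ltW.
have /andP[e0 e1] := eta_range tI.
by rewrite t0 tT /fraction divr_ge0 ?(ltW es0)//= ltr_pdivrMr// mul1r.
Unshelve. all: by end_near. Qed.

Let fraction_cvg : fraction t @[t --> T^'-] --> (1 : R).
Proof.
have [c c0 kc] := k_lower.
have -> : (1 : R) = es / es by rewrite mulfV// gt_eqF.
by apply: cvgMl; exact: (eta_cvg es0 c0 k0 kc k_cont (eta_init heta) (eta_cont heta) eta_d (eta_lt heta)).
Qed.

Let fraction_within :
  fraction t @[t --> T^'-] --> within `[0%R, 1%R]%classic (nbhs (1 : R)).
Proof.
apply: cvg_within_of; first exact: fraction_cvg.
apply: filterS fraction01 => t [_ /andP[e0 e1]].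
by rewrite /= in_itv/= e0 ltW.
Qed.

Let fraction_left : fraction t @[t --> T^'-] --> (1 : R)^'-.
Proof.
apply: (@cvg_within_of _ _ _ _ fraction [set x | x < 1]); first exact: fraction_cvg.
by apply: filterS fraction01 => t [_ /andP[e0 e1]].
Qed.

Let normE p : 1 <= p -> \forall t \near T^'-,
  Lp_norm01 p (ux^~ t) = (((amplitude lam m0 w b p (fraction t))%:E *
    \int[mu]_(x in `[0%R, 1%R]) (dev w b p (fraction t) x)%:E) `^ p^-1)%E.
Proof.
move=> p1; apply: filterS fraction01 => t [tT /andP[e0 e1]].
apply: (norm_along_flow bE hlam es0 mN N0 hw wp JE hrep) => //.
by apply: eta_range; case/andP: tT => t0 ->; rewrite ltW.
Qed.

Lemma norm_cvg_profile p : 1 <= p -> - q^-1 < b - p ->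
  exists L : R, Lp_norm01 p (ux^~ t) @[t --> T^'-] --> L%:E.
Proof.
move=> p1 kbp; have p0 : 0 < p by rewrite (lt_le_trans ltr01).
have [l l0 al] := amplitude_cvg bE hlam es0 hw p0.
pose D e := \int[mu]_(x in `[0%R, 1%R]) dev w b p e x.
have Dl := dev_cvg hw b0 p1 kbp.
have D0 e : 0 <= D e by apply: Rintegral_ge0 => x _; exact: dev_ge0.
exists ((l * D 1) `^ p^-1).
have c1 : amplitude lam m0 w b p (fraction t) * D (fraction t) @[t --> T^'-] --> l * D 1.
  apply: cvgM; first exact: (cvg_comp _ _ fraction_within al).
  exact: (cvg_comp _ _ fraction_within Dl).
have c2 : `|amplitude lam m0 w b p (fraction t) * D (fraction t)| @[t --> T^'-] -->
    `|l * D 1| by exact: cvg_norm.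
have lD0 : 0 <= l * D 1 by rewrite mulr_ge0// ltW.
have pV0 : 0 < p^-1 by rewrite invr_gt0.
have c3 : `|amplitude lam m0 w b p (fraction t) * D (fraction t)| `^ p^-1
    @[t --> T^'-] --> (l * D 1) `^ p^-1.
  by apply: cvg_powR_ge0 => //; rewrite -(ger0_norm lD0).
have : (`|amplitude lam m0 w b p (fraction t) * D (fraction t)| `^ p^-1)%:E
   @[t --> T^'-] --> ((l * D 1) `^ p^-1)%:E by apply: cvg_EFin; [exact: nearW|exact: c3].
apply: cvg_trans; apply: near_eq_cvg.
apply: filterS2 fraction01 (normE p1) => t [_ e01] ->.
have A0 : 0 <= amplitude lam m0 w b p (fraction t) * D (fraction t).
  by rewrite mulr_ge0 ?amplitude_ge0.
by rewrite (ger0_norm A0) (dev_EFin hw b0 p1 e01) -EFinM poweR_EFin.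
Qed.

Lemma norm_dvg_profile p c d0 : 1 <= p -> b - p + q^-1 < 0 -> 0 < c -> 0 < d0 ->
  (forall d, 0 < d < d0 ->
    ((c * d `^ q^-1)%:E <= mu (`[0%R, 1%R]%classic `&` [set x | (w x <= d)%R]))%E) ->
  Lp_norm01 p (ux^~ t) @[t --> T^'-] --> +oo%E.
Proof.
move=> p1 bp c0 d00 Hc; have p0 : 0 < p by rewrite (lt_le_trans ltr01).
have [l l0 al] := amplitude_cvg bE hlam es0 hw p0.
apply/cvgeyPge => A.
have A0 : 0 <= `|A| `^ p by exact: powR_ge0.
have al2 := cvg_comp _ _ fraction_within al.
have l2 : l / 2 < l by rewrite ltr_pdivrMr// mulr_natr mulr2n ltrDl.
have ha : \forall t \near T^'-, l / 2 < amplitude lam m0 w b p (fraction t).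
  have := @cvgr_gt R _ _ _ _ _ al2 _ l2; exact.
have [P PE] : exists P : R -> Prop, forall e, P e =
    ((2 / l * `|A| `^ p)%:E <=
     \int[mu]_(x in `[0%R, 1%R]) (dev w b p e x)%:E)%E :> Prop by eexists.
have hP : \forall e \near (1 : R)^'-, P e.
  apply: filterS (dev_lower hw b0 p1 c0 d00 bp Hc (2 / l * `|A| `^ p)) => e.
  by rewrite PE.
have hd : \forall t \near T^'-, P (fraction t) by exact: (fraction_left hP).
apply: filterS3 ha hd (normE p1) => t h1; rewrite PE => h2 ->.
apply: (@le_trans _ _ (`|A|)%:E); first by rewrite lee_fin ler_norm.
apply: (@le_trans _ _ ((`|A| `^ p)%:E `^ p^-1)%E).
  by rewrite poweR_EFin -powRrM mulfV ?gt_eqF// powRr1.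
apply: gt0_ler_poweR.
- by rewrite invr_ge0 ltW.
- by rewrite in_itv/= lee_fin A0 leey.
- rewrite in_itv/= leey andbT mule_ge0 ?lee_fin ?(le_trans _ (ltW h1)) ?divr_ge0 ?(ltW l0)//.
  by apply: integral_ge0 => x _; rewrite lee_fin dev_ge0.
apply: (@le_trans _ _ ((l / 2)%:E * (2 / l * `|A| `^ p)%:E)%E).
  rewrite -EFinM lee_fin mulrA (_ : l / 2 * (2 / l) = 1) ?mul1r//.
  by field; rewrite gt_eqF.
apply: lee_pmul.
- by rewrite lee_fin divr_ge0// ltW.
- by rewrite lee_fin mulr_ge0// divr_ge0// ltW.
- by rewrite lee_fin ltW.
- exact: h2.
Qed.

End with_profile.

Lemma norm_cvg p : 1 <= p -> - q^-1 < b - p ->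
  exists L : R, Lp_norm01 p (ux^~ t) @[t --> T^'-] --> L%:E.
Proof.
have [N [w [B [C [_ [_ [[mN N0 hw wp] [_ JE]]]]]]]] :=
  profile_exists hlam hq hC2 hdata hmin horder.
exact: (norm_cvg_profile mN N0 hw wp JE).
Qed.

Lemma norm_dvg p : 1 <= p -> b - p + q^-1 < 0 ->
  Lp_norm01 p (ux^~ t) @[t --> T^'-] --> +oo%E.
Proof.
have [N [w [B [C [c [d0 [[mN N0 hw wp] [[c0 d00 Hc] JE]]]]]]]] :=
  profile_exists hlam hq hC2 hdata hmin horder.
by move=> p1 bp; exact: (norm_dvg_profile mN N0 hw wp JE p1 bp c0 d00 Hc).
Qed.

End limits.

Theorem theorem3p107 (R : realType) (lam q C2 m0 : R) (u0 du0 eta : R -> R)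
    (u ux gam : R -> R -> R)
    (hlam : lam < 0) (hq : 0 < q) (hC2 : 0 < C2)
    (hdata : initial_data u0 du0)
    (hmin : negative_minimum du0 m0)
    (horder : forall a, du0 a = m0 -> min_order du0 m0 C2 q a)
    (heta : eta_solution lam du0 m0 eta)
    (hsol : ibvp_solution lam u0 du0 (t_star lam du0 m0) u ux gam)
    (hrep : representation lam du0 (t_star lam du0 m0) eta ux gam) :
  [/\ q < 2^-1 ->
      forall p : R,
        (1 <= p <= 2) \/ (2 < p /\ (2 - p)^-1 < lam) ->
        not_exceptional lam q p ->
        exists L : R,
          Lp_norm01 p (ux^~ t) @[t --> (t_star lam du0 m0)^'-] --> L%:E,
      2^-1 < q < 1 ->
      forall p : R,
        (1 <= p <= q^-1) \/ (q^-1 < p /\ q / (1 - p * q) < lam) ->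
        not_exceptional lam q p ->
        exists L : R,
          Lp_norm01 p (ux^~ t) @[t --> (t_star lam du0 m0)^'-] --> L%:E
    & 1 < q ->
      (forall p : R,
         1 <= p -> q / (1 - p * q) < lam ->
         exists L : R,
           Lp_norm01 p (ux^~ t) @[t --> (t_star lam du0 m0)^'-] --> L%:E) /\
      (forall p : R,
         1 < p -> lam < q / (p * (1 - q)) ->
         Lp_norm01 p (ux^~ t) @[t --> (t_star lam du0 m0)^'-] --> +oo%E)].
Proof.
have b0 : 0 < - lam^-1 by rewrite oppr_gt0 invr_lt0.
have cvg p : 1 <= p -> - q^-1 < - lam^-1 - p -> exists L : R,
    Lp_norm01 p (ux^~ t) @[t --> (t_star lam du0 m0)^'-] --> L%:E.
  exact: (norm_cvg hlam hq hC2 hdata hmin horder heta hrep erefl).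
have dvg p : 1 <= p -> - lam^-1 - p + q^-1 < 0 ->
    Lp_norm01 p (ux^~ t) @[t --> (t_star lam du0 m0)^'-] --> +oo%E.
  exact: (norm_dvg hlam hq hC2 hdata hmin horder heta hrep erefl).
have lamV (x y : R) : x < 0 -> y < 0 -> x^-1 < y -> y^-1 < x.
  by move=> x0 y0 xy; rewrite -[ltRHS]invrK ltf_nV2 ?negrE ?invr_lt0.
have lamV' (x y : R) : x < 0 -> y < 0 -> y < x^-1 -> x < y^-1.
  by move=> x0 y0 xy; rewrite -[ltLHS]invrK ltf_nV2 ?negrE ?invr_lt0.
have qV0 : 0 < q^-1 by rewrite invr_gt0.
have pq_case (p : R) : 1 < p * q -> q / (1 - p * q) < lam -> - q^-1 < - lam^-1 - p.
  move=> pq hl; have x0 : (1 - p * q) / q < 0 by rewrite pmulr_llt0// subr_lt0.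
  have := lamV ((1 - p * q) / q) lam x0 hlam; rewrite invf_div => /(_ hl).
  have -> : (1 - p * q) / q = q^-1 - p by field; rewrite gt_eqF.
  by lra.
split.
- move=> q2 p hp _.
  have q2' : 2 < q^-1 by rewrite -[ltLHS]invrK ltf_pV2 ?posrE ?invr_gt0.
  case: hp => [/andP[p1 p2]|[p2 hl]]; apply: cvg; [by []|by lra|by lra|].
  have p20 : 2 - p < 0 by lra.
  by have := lamV _ _ p20 hlam hl; lra.
- move=> /andP[_ q1] p hp _.
  have q1' : 1 < q^-1 by rewrite invf_gt1.
  case: hp => [/andP[p1 pq]|[pq hl]]; apply: cvg; [by []|by lra|by lra|].
  by apply: pq_case => //; rewrite -ltr_pdivrMr// div1r.
- move=> q1; split => p p1 hl.
    apply: cvg => //; apply: pq_case => //.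
    by rewrite (lt_le_trans q1)// ler_peMl// ltW.
  apply: dvg; first exact: ltW.
  have p0 : 0 < p by lra.
  have pq0 : p * (1 - q) / q < 0.
    by rewrite pmulr_llt0// pmulr_rlt0// subr_lt0.
  have := lamV' (p * (1 - q) / q) lam pq0 hlam; rewrite invf_div => /(_ hl).
  have -> : p * (1 - q) / q = p * q^-1 - p by field; rewrite gt_eqF.
  have : q^-1 < p * q^-1 by rewrite ltr_pMl.
  by lra.
Qed.
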